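(* Let $\Lambda$ be a triangular algebra and let $v$ be any vertex in its quiver. Define a sequence of triangular algebras by $\Lambda_0=\Lambda^-$, $\Lambda_1=\Lambda$ and $\Lambda_i=\Lambda\xleftarrow{v}\overrightarrow{A_i}$ for $i\ge1$, where $\overrightarrow{A_i}$ is a chain with $i$ elements. Then (i) $\deg\phi_{\Lambda_{i+1}}=\deg\phi_{\Lambda_i}+1$ for all $i\ge0$; (ii) $\phi_{\Lambda_{i+1}}(x)=(x+1)\cdot\phi_{\Lambda_i}(x)-x\cdot\phi_{\Lambda_{i-1}}(x)$ for all $i\ge1$.
   Context: Let $K$ be a field. For a finite quiver $Q$ with vertex set $Q_0$ and arrow set $Q_1$, write $h(\alpha)$ and $t(\alpha)$ for the vertices at which an arrow (or path) $\alpha$ starts and ends, respectively; paths are composed from left to right, and two paths $p,q$ are parallel if $h(p)=h(q)$ and $t(p)=t(q)$. A triangular algebra is a quotient $\Lambda = KQ/I$ where $Q$ is a finite quiver without oriented cycles and $I$ is an ideal generated by linear combinations of parallel paths of lengths at least $2$. Its Cartan matrix $C_\Lambda$ is indexed by $Q_0$, with $(C_\Lambda)_{ij} = \dim_K \mathrm{Hom}_\Lambda(P_i,P_j)$, $P_i = e_i\Lambda$; this is the dimension of the image in $KQ/I$ of the span of paths from $j$ to $i$. Its Coxeter polynomial is $\phi_\Lambda(x) = \det(xC_\Lambda + C_\Lambda^T)$ (equal to $1$ for the zero algebra). For $v\in Q_0$, $e_v$ is the corresponding primitive idempotent and $\Lambda^- = (1-e_v)\Lambda(1-e_v)$. The Hasse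 quiver $Q_S$ of a finite poset $S$ has the elements of $S$ as vertices and an arrow $s\to s'$ whenever $s'$ covers $s$. $S_{\min}$ and $S_{\max}$ are the sets of minimal and maximal elements of $S$. Insertion: let $\Lambda = KQ/I$ be a triangular algebra, $v\in Q_0$, $S$ a nonempty finite poset. The insertion $\Lambda \xleftarrow{v} S$ is $K\widetilde{Q}/\widetilde{I}$, where $\widetilde{Q}_0 = (Q_0\setminus\{v\})\cup S$, and $\widetilde{Q}_1$ consists of: the arrows $\gamma\in Q_1$ with $h(\gamma),t(\gamma)\ne v$; the arrows of $Q_S$; an arrow $(\alpha,s)$ from $h(\alpha)$ to $s$ for each $\alpha\in Q_1$ with $t(\alpha)=v$ and $s\in S_{\min}$; an arrow $(s,\beta)$ from $s$ to $t(\beta)$ for each $\beta\in Q_1$ with $h(\beta)=v$ and $s\in S_{\max}$. For a path $p$ in $Q$ ending at $v$ and $s\in S_{\min}$, let $(p,s)$ be obtained from $p$ by replacing its last arrow $\alpha$ by $(\alpha,s)$; define $(s,p)$ similarly for $p$ starting at $v$ and $s\in S_{\max}$. The ideal $\widetilde{I}$ is generated by: (1a) $\sum c_p (p,s)$ for $s\in S_{\min}$ and $\sum c_p p\in I$ a linear combination of parallel paths ending at $v$; (1b) $\sum c_p (s,p)$ for $s\in S_{\max}$ and $\sum c_p p\in I$ a linear combination of parallel paths starting at $v$; (2a) $q'-q''$ for parallel paths $q',q''$ in $Q_S$; (2b) $(\alpha,h(q'))q' - (\alpha,h(q''))q''$ for $\alpha\in Q_1$ ending at $v$ and paths $q',q''$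 in $Q_S$ with $h(q'),h(q'')\in S_{\min}$, $t(q')=t(q'')$; (2c) $q'(t(q'),\beta)-q''(t(q''),\beta)$ for $\beta\in Q_1$ starting at $v$ and paths $q',q''$ in $Q_S$ with $t(q'),t(q'')\in S_{\max}$, $h(q')=h(q'')$; (2d) $(\alpha,h(q'))q'(t(q'),\beta)-(\alpha,h(q''))q''(t(q''),\beta)$ for $\alpha,\beta\in Q_1$ with $t(\alpha)=h(\beta)=v$ and paths $q',q''$ in $Q_S$ with $h(q'),h(q'')\in S_{\min}$, $t(q'),t(q'')\in S_{\max}$; (3) $\sum c_p\widetilde{p}$ for $\sum c_p p\in I$ a linear combination of parallel paths neither starting nor ending at $v$, where $\widetilde{p}=p$ if $p$ does not pass through $v$, and otherwise, writing $p=p'p''$ with $t(p')=h(p'')=v$, $\widetilde{p} = (p',h(q))\,q\,(t(q),p'')$ for some path $q$ in $Q_S$ with $h(q)\in S_{\min}$, $t(q)\in S_{\max}$ (the choice of $q$ is irrelevant modulo the other relations). The algebra $\Lambda\xleftarrow{v}S$ is again triangular. For a one-element chain, $\Lambda\xleftarrow{v}\overrightarrow{A_1}$ is identified with $\Lambda$. *)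

(* Defs.v *)
From HB Require Import structures.
From mathcomp Require Import all_boot all_order all_algebra all_field.
From mathcomp Require Import boolp.
Set Implicit Arguments.
Unset Strict Implicit.
Unset Printing Implicit Defensive.
Import Order.TTheory GRing.Theory.
Local Open Scope ring_scope.

Section Span.
Variables (K : fieldType) (V : vectType K).

Lemma spanning_seq (X : V -> Prop) :
  exists2 s : seq V, forall x, x \in s -> X x & forall x, X x -> x \in <<s>>%VS.
Proof.
pose P n := `[< exists2 s : seq V, forall x, x \in s -> X x
                                  & \dim <<s>>%VS = n >].
have exP : exists n, P n.
  by exists (\dim <<([::] : seq V)>>%VS); apply/asboolP; exists [::].
have ubP n : P n -> (n <= \dim {:V})%N.
  by move=> /asboolP[s _ <-]; apply/dimvS/subvf.
case: (ex_maxnP exP ubP) => n /asboolP[s sX <-] smax.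
exists s => // x Xx.
have le1 : (<<s>> <= <<x :: s>>)%VS.
  by apply/span_subvP=> y ys; rewrite memv_span // inE ys orbT.
have le2 : (\dim <<x :: s>> <= \dim <<s>>)%N.
  apply: smax; apply/asboolP; exists (x :: s) => // y.
  by rewrite inE => /predU1P[-> //|/sX].
have /eqP -> : <<s>>%VS == <<x :: s>>%VS by rewrite eqEdim le1.
by rewrite memv_span // mem_head.
Qed.

Lemma vspan_exists (X : V -> Prop) : exists U : {vspace V},
  (forall x, X x -> x \in U) /\
  (forall W : {vspace V}, (forall x, X x -> x \in W) -> (U <= W)%VS).
Proof.
have [s sX Xs] := spanning_seq X; exists <<s>>%VS; split=> // W XW.
by apply/span_subvP => x /sX /XW.
Qed.

(* The subspace spanned by an arbitrary (possibly infinite) subset. *)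
Definition vspan (X : V -> Prop) : {vspace V} := projT1 (cid (vspan_exists X)).

Lemma mem_vspan (X : V -> Prop) x : X x -> x \in vspan X.
Proof. by rewrite /vspan; case: cid => U [UX _] /= /UX. Qed.

Lemma vspan_sub (X : V -> Prop) (W : {vspace V}) :
  (forall x, X x -> x \in W) -> (vspan X <= W)%VS.
Proof. by rewrite /vspan; case: cid => U [_ Umin] /= /Umin. Qed.

Lemma vspanP (X : V -> Prop) x : X 0 ->
  (forall a u w, X u -> X w -> X (a *: u + w)) -> x \in vspan X <-> X x.
Proof.
move=> X0 XD; split=> [|/mem_vspan //].
have [s sX /vspan_sub sP] := spanning_seq X.
move=> /(subvP sP)/(@coord_span _ _ _ (in_tuple s)) ->.
apply: (big_ind X) => // [u w Xu Xw|i _].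
  by rewrite -[u]scale1r; apply: XD.
by rewrite -[_ *: _]addr0; apply: XD => //; apply: sX; rewrite mem_nth.
Qed.

End Span.

Section Quotient.
Variables (K : fieldType) (A : falgType K).

Definition is_ideal (I : {vspace A}) :=
  forall a x, x \in I -> a * x \in I /\ x * a \in I.

Definition ideal_gen (X : A -> Prop) : {vspace A} :=
  vspan (fun y => exists a x b, X x /\ y = a * x * b).

Lemma mem_ideal_gen (X : A -> Prop) x : X x -> x \in ideal_gen X.
Proof. by move=> Xx; apply: mem_vspan; exists 1, x, 1; rewrite mul1r mulr1. Qed.

Lemma ideal_gen_is_ideal (X : A -> Prop) : is_ideal (ideal_gen X).
Proof.
move=> a x xI; split.
- suff : (ideal_gen X <= amull a @^-1: ideal_gen X)%VS.
    by move/subvP/(_ _ xI); rewrite -memv_preim lfunE.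
  apply: vspan_sub => y [b [z [c [Xz ->]]]]; rewrite -memv_preim lfunE /=.
  by apply: mem_vspan; exists (a * b), z, c; rewrite !mulrA.
- suff : (ideal_gen X <= amulr a @^-1: ideal_gen X)%VS.
    by move/subvP/(_ _ xI); rewrite -memv_preim lfunE.
  apply: vspan_sub => y [b [z [c [Xz ->]]]]; rewrite -memv_preim lfunE /=.
  by apply: mem_vspan; exists b, z, (c * a); rewrite !mulrA.
Qed.

Lemma ideal_gen_sub (X : A -> Prop) (J : {vspace A}) :
  is_ideal J -> (forall x, X x -> x \in J) -> (ideal_gen X <= J)%VS.
Proof.
move=> idJ XJ; apply: vspan_sub => _ [a [x [b [Xx ->]]]].
by have /(_ x (XJ x Xx))[/(idJ b)[_ ?]] := idJ a.
Qed.

Record proper_bideal := ProperBideal {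
  ideal_vs :> {vspace A};
  ideal_vsP : is_ideal ideal_vs;
  ideal_proper : 1 \notin ideal_vs }.

(* The quotient algebra A / I is carried by a linear complement of I; qproj
   below is the surjective algebra morphism from A with kernel I. *)
Definition quot (I : proper_bideal) : Type := subvs_of (I^C)%VS.

HB.instance Definition _ I := Vector.on (quot I).

Section QuotRing.
Variable I : proper_bideal.

Definition qproj (x : A) : quot I := Subvs (memv_pi (I^C) I x).

Fact qproj_is_linear : linear qproj.
Proof. by move=> a x y; apply: val_inj; rewrite /= linearP. Qed.
HB.instance Definition _ := GRing.isLinear.Build K A (quot I) _ qproj
  qproj_is_linear.

Lemma cap_compl : (I^C :&: I = 0)%VS.
Proof. by rewrite capvC capv_compl. Qed.

Lemma vsvalK : cancel (vsval : quot I -> A) qproj.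
Proof. by case=> u uI; apply: val_inj; rewrite /= daddv_pi_id // cap_compl. Qed.

Lemma qproj_sub x : x - vsval (qproj x) \in I.
Proof.
have /(_ x) := @daddv_pi_add _ _ (I^C)%VS I _ cap_compl.
rewrite addvC addv_complf memvf => /(_ isT) {1}<-.
by rewrite addrAC subrr add0r memv_pi.
Qed.

Lemma qproj_eq0 x : (qproj x == 0) = (x \in I).
Proof.
apply/eqP/idP => [qx0|xI]; first by have := qproj_sub x; rewrite qx0 subr0.
apply/val_inj/eqP; rewrite -memv0 -cap_compl memv_cap memv_pi /=.
by rewrite -[daddv_pi _ _ _](subKr x) rpredB // qproj_sub.
Qed.

Lemma qproj_eq x y : (qproj x == qproj y) = (x - y \in I).
Proof. by rewrite -qproj_eq0 linearB subr_eq0. Qed.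

Definition qone : quot I := qproj 1.
Definition qmul (u w : quot I) : quot I := qproj (vsval u * vsval w).

Lemma qprojM x y : qproj (x * y) = qmul (qproj x) (qproj y).
Proof.
apply/eqP; rewrite qproj_eq.
rewrite -(subrKA (x * vsval (qproj y))) -mulrBr -mulrBl.
have [I1 _] := ideal_vsP x (qproj_sub y).
by have [_ I2] := ideal_vsP (vsval (qproj y)) (qproj_sub x); rewrite rpredD.
Qed.

Fact qmulA : associative qmul.
Proof.
move=> u w z; rewrite -[u]vsvalK -[w]vsvalK -[z]vsvalK.
by rewrite -!qprojM mulrA.
Qed.
Fact qmul1 : left_id qone qmul.
Proof. by move=> u; rewrite -[u]vsvalK -qprojM mul1r. Qed.
Fact qmulr1 : right_id qone qmul.
Proof. by move=> u; rewrite -[u]vsvalK -qprojM mulr1. Qed.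
Fact qmulDl : left_distributive qmul +%R.
Proof. by move=> u w z; rewrite /qmul linearD mulrDl linearD. Qed.
Fact qmulDr : right_distributive qmul +%R.
Proof. by move=> u w z; rewrite /qmul linearD mulrDr linearD. Qed.
Fact qone_neq0 : qone != 0.
Proof. by rewrite qproj_eq0 ideal_proper. Qed.

HB.instance Definition _ := GRing.Zmodule_isNzRing.Build (quot I)
  qmulA qmul1 qmulr1 qmulDl qmulDr qone_neq0.

Fact qscalerAl (a : K) (u w : quot I) : a *: (u * w) = (a *: u) * w.
Proof. by rewrite /GRing.mul /= /qmul linearZ /= -scalerAl linearZ. Qed.
HB.instance Definition _ := GRing.Lmodule_isLalgebra.Build K (quot I) qscalerAl.

Fact qscalerAr (a : K) (u w : quot I) : a *: (u * w) = u * (a *: w).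
Proof. by rewrite /GRing.mul /= /qmul linearZ /= -scalerAr linearZ. Qed.
HB.instance Definition _ := GRing.Lalgebra_isAlgebra.Build K (quot I) qscalerAr.
HB.instance Definition _ := Algebra_isFalgebra.Build K (quot I).

Fact qproj_monoid : monoid_morphism qproj.
Proof. by split=> // x y; apply: qprojM. Qed.
HB.instance Definition _ := GRing.isMonoidMorphism.Build A (quot I) qproj
  qproj_monoid.

End QuotRing.
End Quotient.

(* A finite-dimensional algebra with a family of idempotents.  It is given as a
   multiplicatively closed subspace of an ambient algebra, because a corner
   e A e does not have the unit of A and may be zero, which falgType excludes. *)
Record based_algebra (K : fieldType) := BasedAlgebra {
  ambient : falgType K;
  carrier : {vspace ambient};
  points : finType;
  idem : points -> ambient }.

Section Cartan.
Variables (K : fieldType).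

(* Hom_B(U, W), for right B-modules U, W inside the ambient algebra. *)
Definition module_hom (L : falgType K) (B U W : {vspace L}) :
    {vspace 'Hom(subvs_of U, subvs_of W)} :=
  vspan (fun f : 'Hom(subvs_of U, subvs_of W) =>
    forall (u u' : subvs_of U) (b : L), b \in B ->
      vsval u' = vsval u * b -> vsval (f u') = vsval (f u) * b).

Lemma module_homP (L : falgType K) (B U W : {vspace L})
    (f : 'Hom(subvs_of U, subvs_of W)) :
  f \in module_hom B U W <->
  forall (u u' : subvs_of U) (b : L), b \in B ->
    vsval u' = vsval u * b -> vsval (f u') = vsval (f u) * b.
Proof.
apply: vspanP => [u u' b _ _|a g g' Xg Xg' u u' b Bb uu'].
  by rewrite !lfunE /= mul0r.
rewrite !add_lfunE !scale_lfunE !linearP /= (Xg' _ _ _ Bb uu').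
by rewrite (Xg _ _ _ Bb uu') mulrDl scalerAl.
Qed.

Variable A : based_algebra K.

Definition proj_module (i : points A) : {vspace ambient A} :=
  (<[idem i]> * carrier A)%VS.

Definition cartan : 'M[int]_#|points A| :=
  \matrix_(i, j) (\dim (module_hom (carrier A) (proj_module (enum_val i))
                                 (proj_module (enum_val j))))%:R.

Definition coxeter_poly : {poly int} :=
  \det ('X *: map_mx polyC cartan + (map_mx polyC cartan)^T).

End Cartan.

Section Walks.
Variables (V A : eqType) (hd tl : A -> V).

(* The word w of arrows is composable, from left to right, starting at x. *)
Fixpoint walk (x : V) (w : seq A) : bool :=
  if w is a :: w' then (hd a == x) && walk (tl a) w' else true.

Definition wend (x : V) (w : seq A) : V := last x (map tl w).

Definition acyclic : Prop :=
  forall x w, walk x w -> wend x w = x -> w = [::].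

Lemma walk_cat x w w' : walk x (w ++ w') = walk x w && walk (wend x w) w'.
Proof.
by rewrite /wend; elim: w x => //= a w IH x; rewrite IH andbA.
Qed.

Lemma wend_cat x w w' : wend x (w ++ w') = wend (wend x w) w'.
Proof. by rewrite /wend map_cat last_cat. Qed.

Lemma acyclic_uniq : acyclic -> forall x w, walk x w -> uniq (x :: map tl w).
Proof.
move=> acy x w; elim: w x => [|a w IH] x //= /andP[/eqP <- wP].
rewrite -[X in _ && X]/(uniq (tl a :: map tl w)) IH // andbT -map_cons.
apply/mapP => -[b bw hb].
have : walk (hd a) (a :: w) by rewrite /= eqxx.
case/path.splitPr: bw => s1 s2; rewrite -cat_rcons walk_cat => /andP[/acy E _].
have /(congr1 size) : rcons s1 b = [::].
  by apply: E; rewrite /wend map_rcons last_rcons.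
by rewrite size_rcons.
Qed.

End Walks.

(* Finite quivers without oriented cycles: the arrow a goes from hd a to tl a.
   They are taken nonempty, so that K Q / I is a nonzero ring. *)
Record quiver := Quiver {
  vert : finType;
  arr : finType;
  hd : arr -> vert;
  tl : arr -> vert;
  quiver_acyclic : acyclic hd tl;
  quiver_nonempty : (0 < #|vert|)%N }.

Notation qwalk Q := (walk (@hd Q) (@tl Q)).
Notation qend Q := (wend (@tl Q)).

Lemma walk_size (Q : quiver) (x : vert Q) w :
  qwalk Q x w -> (size w < #|vert Q|)%N.
Proof.
move=> /(acyclic_uniq (@quiver_acyclic Q)) /card_uniqP /= E.
by rewrite -(size_map (@tl Q)) -E max_card.
Qed.

(* A path is a start vertex with a composable word of arrows.  Bounding the
   length makes the type finite and loses no path, by walk_size. *)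
Definition qpath (Q : quiver) : finType :=
  {p : vert Q * #|vert Q|.-bseq (arr Q) | qwalk Q p.1 p.2}.

Section Paths.
Variable Q : quiver.
Implicit Types p q r : qpath Q.

Definition pstart p : vert Q := (val p).1.
Definition parrows p : seq (arr Q) := (val p).2.
Definition pend p : vert Q := qend Q (pstart p) (parrows p).

Lemma parrowsP p : qwalk Q (pstart p) (parrows p).
Proof. exact: (valP p). Qed.

Lemma qpath_inj p q : pstart p = pstart q -> parrows p = parrows q -> p = q.
Proof.
move=> Es Ea; apply: val_inj; move: Es Ea; rewrite /pstart /parrows.
by case: (val p) (val q) => [x s] [y t] /= -> /val_inj ->.
Qed.

Lemma qpath_of x w : qwalk Q x w -> {p | pstart p = x & parrows p = w}.
Proof.
move=> wP; have wS : (size w <= #|vert Q|)%N by rewrite ltnW // (walk_size wP).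
by exists (exist _ (x, Bseq wS) wP : qpath Q).
Qed.

(* r = p q, where p comes first *)
Definition is_comp p q r : bool :=
  [&& pstart r == pstart p, pend p == pstart q &
      parrows r == parrows p ++ parrows q].

End Paths.

Section PathAlgebra.
Variables (K : fieldType) (Q : quiver).

(* f : path_alg is the linear combination of the paths p with coefficients
   f p. *)
Definition path_alg : Type := {ffun qpath Q -> K^o}.

HB.instance Definition _ := Vector.on path_alg.

Implicit Types f g h : path_alg.
Definition pcoef f (p : qpath Q) : K := (f : {ffun qpath Q -> K^o}) p.

Definition path_mul f g : path_alg :=
  [ffun r => \sum_p \sum_(q | is_comp p q r) pcoef f p * pcoef g q].
Definition path_one : path_alg := [ffun p => (parrows p == [::])%:R].

Lemma pcoefP f g : pcoef f =1 pcoef g -> f = g.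
Proof. by move=> E; apply/ffunP. Qed.
Lemma pcoefD f g p : pcoef (f + g) p = pcoef f p + pcoef g p.
Proof. by rewrite /pcoef ffunE. Qed.
Lemma pcoefZ a f p : pcoef (a *: f) p = a * pcoef f p.
Proof. by rewrite /pcoef ffunE. Qed.
Lemma pcoef0 p : pcoef 0 p = 0.
Proof. by rewrite /pcoef ffunE. Qed.
Lemma pcoef_mul f g r :
  pcoef (path_mul f g) r = \sum_p \sum_(q | is_comp p q r) pcoef f p * pcoef g q.
Proof. by rewrite /pcoef ffunE. Qed.
Lemma pcoef_one p : pcoef path_one p = (parrows p == [::])%:R.
Proof. by rewrite /pcoef ffunE. Qed.

Definition is_comp3 (p q r t : qpath Q) : bool :=
  [&& pstart t == pstart p, pend p == pstart q, pend q == pstart r &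
      parrows t == parrows p ++ parrows q ++ parrows r].

Lemma is_comp_end (p q u : qpath Q) : is_comp p q u -> pend u = pend q.
Proof.
case/and3P=> /eqP su /eqP pq /eqP au.
by rewrite /pend su au wend_cat -pq.
Qed.

Lemma sum_comp_l (p q r t : qpath Q) (x : K) :
  \sum_(u | is_comp p q u && is_comp u r t) x = if is_comp3 p q r t then x else 0.
Proof.
case: ifP => [/and4P[/eqP st /eqP pq /eqP qr /eqP at_]|nt].
  have wP : qwalk Q (pstart p) (parrows p ++ parrows q).
    by rewrite walk_cat parrowsP -/(pend p) pq parrowsP.
  have [u su au] := qpath_of wP.
  have cu : is_comp p q u by rewrite /is_comp su au pq !eqxx.
  rewrite (big_pred1 u) // => u'; apply/idP/eqP => [/andP[/and3P[/eqP s' _ /eqP a'] _]|->].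
    by apply: qpath_inj; rewrite ?su ?au.
  rewrite cu /is_comp (is_comp_end cu) st su qr at_ au catA !eqxx //.
apply: big_pred0 => u; apply: contraFF nt => /andP[cu].
rewrite /is_comp3 => /and3P[/eqP st /eqP ur /eqP at_].
move: (is_comp_end cu); case/and3P: cu => /eqP su pq /eqP au eu.
by rewrite st su pq -eu ur at_ au catA !eqxx.
Qed.

Lemma sum_comp_r (p q r t : qpath Q) (x : K) :
  \sum_(u | is_comp q r u && is_comp p u t) x = if is_comp3 p q r t then x else 0.
Proof.
case: ifP => [/and4P[/eqP st /eqP pq /eqP qr /eqP at_]|nt].
  have wP : qwalk Q (pstart q) (parrows q ++ parrows r).
    by rewrite walk_cat parrowsP -/(pend q) qr parrowsP.
  have [u su au] := qpath_of wP.
  have cu : is_comp q r u by rewrite /is_comp su au qr !eqxx.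
  rewrite (big_pred1 u) // => u'; apply/idP/eqP => [/andP[/and3P[/eqP s' _ /eqP a'] _]|->].
    by apply: qpath_inj; rewrite ?su ?au.
  by rewrite cu /is_comp st pq su at_ au !eqxx.
apply: big_pred0 => u; apply: contraFF nt => /andP[].
case/and3P => /eqP su qr /eqP au /and3P[st pu /eqP at_].
by rewrite /is_comp3 st -su pu qr at_ au !eqxx.
Qed.

Fact path_mulA : associative path_mul.
Proof.
move=> f g h; apply: pcoefP => t; rewrite !pcoef_mul.
transitivity (\sum_p \sum_q \sum_r
    if is_comp3 p q r t then pcoef f p * pcoef g q * pcoef h r else 0).
  apply: eq_bigr => p _; rewrite (eq_bigr (fun u => \sum_q \sum_r
    if is_comp q r u then pcoef f p * pcoef g q * pcoef h r else 0)).
    rewrite exchange_big; apply: eq_bigr => q _.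
    rewrite exchange_big; apply: eq_bigr => r _.
    by rewrite -big_mkcondr /= -sum_comp_r; apply: eq_bigl => u; rewrite andbC.
  move=> u _; rewrite pcoef_mul mulr_sumr; apply: eq_bigr => q _.
  by rewrite mulr_sumr big_mkcond; apply: eq_bigr => r _; rewrite mulrA.
symmetry.
transitivity (\sum_u \sum_p \sum_q \sum_r
    if is_comp p q u && is_comp u r t then pcoef f p * pcoef g q * pcoef h r else 0).
  apply: eq_bigr => u _.
  transitivity (\sum_r \sum_p \sum_q
    if is_comp p q u && is_comp u r t then pcoef f p * pcoef g q * pcoef h r else 0).
    rewrite big_mkcond; apply: eq_bigr => r _; case: ifP => _; last first.
      by rewrite big1 // => p _; rewrite big1 // => q _; rewrite andbF.
    rewrite pcoef_mul mulr_suml; apply: eq_bigr => p _.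
    rewrite mulr_suml big_mkcond; apply: eq_bigr => q _; rewrite andbT.
    by case: ifP => //; rewrite mul0r.
  rewrite exchange_big; apply: eq_bigr => p _.
  by rewrite exchange_big; apply: eq_bigr => q _.
rewrite exchange_big; apply: eq_bigr => p _.
rewrite exchange_big; apply: eq_bigr => q _.
rewrite exchange_big; apply: eq_bigr => r _.
by rewrite -big_mkcond /= sum_comp_l.
Qed.

Lemma triv_path x : {p : qpath Q | pstart p = x & parrows p = [::]}.
Proof. exact: qpath_of. Qed.

Fact path_mul1 : left_id path_one path_mul.
Proof.
move=> f; apply: pcoefP => r; rewrite pcoef_mul.
have [e se ae] := triv_path (pstart r).
rewrite (bigD1 e) //= [X in _ + X]big1 ?addr0 => [|p ep].
  rewrite (big_pred1 r) ?pcoef_one ?ae ?mul1r // => q.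
  rewrite /is_comp /pend se ae /= eqxx /=; apply/andP/eqP => [[/eqP s /eqP a]|->].
    exact: qpath_inj.
  by rewrite !eqxx.
rewrite big1 // => q /and3P[/eqP sr _ _]; rewrite pcoef_one.
case: eqP => [ap|]; last by rewrite mul0r.
by case/eqP: ep; apply: qpath_inj; rewrite ?se ?ae.
Qed.

Fact path_mulr1 : right_id path_one path_mul.
Proof.
move=> f; apply: pcoefP => r; rewrite pcoef_mul.
have [e se ae] := triv_path (pend r).
rewrite (bigD1 r) //= [X in _ + X]big1 ?addr0 => [|p rp].
  rewrite (big_pred1 e) ?pcoef_one ?ae ?mulr1 // => q.
  rewrite /is_comp eqxx /=; apply/andP/eqP => [[/eqP s /eqP a]|->].
    apply: qpath_inj; rewrite ?se ?ae //.
    by move/(congr1 size): a; rewrite size_cat -[LHS]addn0 => /addnI/esym/size0nil.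
  by rewrite se ae cats0 !eqxx.
rewrite big1 // => q /and3P[/eqP sr _ /eqP ar]; rewrite pcoef_one.
case: eqP => [ap|]; last by rewrite mulr0.
by case/eqP: rp; apply: qpath_inj => //; rewrite ar ap cats0.
Qed.

Fact path_mulDl : left_distributive path_mul +%R.
Proof.
move=> f g h; apply: pcoefP => r; rewrite pcoefD !pcoef_mul -big_split.
apply: eq_bigr => p _; rewrite -big_split; apply: eq_bigr => q _.
by rewrite pcoefD mulrDl.
Qed.

Fact path_mulDr : right_distributive path_mul +%R.
Proof.
move=> f g h; apply: pcoefP => r; rewrite pcoefD !pcoef_mul -big_split.
apply: eq_bigr => p _; rewrite -big_split; apply: eq_bigr => q _.
by rewrite pcoefD mulrDr.
Qed.

Fact path_one_neq0 : path_one != 0.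
Proof.
have /card_gt0P[x _] := quiver_nonempty Q; have [e _ ae] := triv_path x.
apply/eqP => /(congr1 (fun f => pcoef f e)); rewrite pcoef_one pcoef0 ae eqxx.
by move/eqP; rewrite oner_eq0.
Qed.

HB.instance Definition _ := GRing.Zmodule_isNzRing.Build path_alg
  path_mulA path_mul1 path_mulr1 path_mulDl path_mulDr path_one_neq0.

Fact path_scalerAl (a : K) f g : a *: (f * g) = (a *: f) * g.
Proof.
apply: pcoefP => r; rewrite pcoefZ !pcoef_mul mulr_sumr; apply: eq_bigr => p _.
by rewrite mulr_sumr; apply: eq_bigr => q _; rewrite pcoefZ mulrA.
Qed.
HB.instance Definition _ := GRing.Lmodule_isLalgebra.Build K path_alg
  path_scalerAl.

Fact path_scalerAr (a : K) f g : a *: (f * g) = f * (a *: g).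
Proof.
apply: pcoefP => r; rewrite pcoefZ !pcoef_mul mulr_sumr; apply: eq_bigr => p _.
by rewrite mulr_sumr; apply: eq_bigr => q _; rewrite pcoefZ mulrCA.
Qed.
HB.instance Definition _ := GRing.Lalgebra_isAlgebra.Build K path_alg
  path_scalerAr.
HB.instance Definition _ := Algebra_isFalgebra.Build K path_alg.

Definition videm (x : vert Q) : path_alg :=
  [ffun p => ((pstart p == x) && (parrows p == [::]))%:R].

Definition supported_from_to (i j : vert Q) (f : path_alg) : Prop :=
  forall p, pcoef f p != 0 -> pstart p = i /\ pend p = j.

(* Linear combinations of parallel paths of length at least 2. *)
Definition is_relation (f : path_alg) : Prop :=
  (exists i j, supported_from_to i j f) /\
  (forall p, pcoef f p != 0 -> (2 <= size (parrows p))%N).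

End PathAlgebra.

Section LongPaths.
Variables (K : fieldType) (Q : quiver).

Lemma ideal_gen_long (X : path_alg K Q -> Prop) :
  (forall f, X f -> is_relation f) ->
  forall f, f \in ideal_gen X ->
    forall p, pcoef f p != 0 -> (2 <= size (parrows p))%N.
Proof.
move=> XP f fI.
pose P (g : path_alg K Q) := forall p, pcoef g p != 0 -> (2 <= size (parrows p))%N.
have comp_size (p q r : qpath Q) : is_comp p q r ->
    (size (parrows p) <= size (parrows r))%N /\ (size (parrows q) <= size (parrows r))%N.
  by case/and3P=> _ _ /eqP ->; rewrite size_cat leq_addr leq_addl.
have PM g h : P g \/ P h -> P (g * h).
  move=> Pgh r; apply: contraNT => rS; rewrite pcoef_mul big1 // => p _.
  rewrite big1 // => q /comp_size[pr qr]; case: Pgh => Pg.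
    have -> : pcoef g p = 0; last by rewrite mul0r.
    by apply/eqP; apply: contraNT rS => /Pg /leq_trans; apply.
  have -> : pcoef h q = 0; last by rewrite mulr0.
  by apply/eqP; apply: contraNT rS => /Pg /leq_trans; apply.
suff: f \in vspan P.
  rewrite vspanP // => [p|a g h Pg Ph p]; first by rewrite pcoef0 eqxx.
  rewrite pcoefD pcoefZ => nz; case: (eqVneq (pcoef h p) 0) => [h0|/Ph //].
  by move: nz; rewrite h0 addr0 mulf_eq0 => /norP[_ /Pg].
apply: subvP fI; apply: vspan_sub => _ [a [x [b [/XP[_ Px] ->]]]].
by apply: mem_vspan; apply: (PM); left; apply: PM; right.
Qed.

End LongPaths.

Record triangular (K : fieldType) := Triangular {
  tquiver :> quiver;
  tideal : {vspace path_alg K tquiver};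
  tidealP : exists2 X : path_alg K tquiver -> Prop,
    (forall f, X f -> is_relation f) & tideal = ideal_gen X }.

Section Triangular.
Variables (K : fieldType) (T : triangular K).

Lemma tideal_long (f : path_alg K T) : f \in tideal T ->
  forall p, pcoef f p != 0 -> (2 <= size (parrows p))%N.
Proof. by have [X XP ->] := tidealP T; apply: ideal_gen_long. Qed.

Lemma tideal_is_ideal : is_ideal (tideal T).
Proof. by have [X _ ->] := tidealP T; apply: ideal_gen_is_ideal. Qed.

Lemma tideal_proper : 1 \notin tideal T.
Proof.
apply/negP => /tideal_long oneP.
have /card_gt0P[x _] := quiver_nonempty T; have [e _ ae] := triv_path x.
by have := oneP e; rewrite pcoef_one ae eqxx oner_eq0 => /(_ isT).
Qed.

Definition tproper_bideal := ProperBideal tideal_is_ideal tideal_proper.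

Definition talg : falgType K := quot tproper_bideal.

Definition tidem (x : vert T) : talg :=
  (qproj tproper_bideal (videm K x) : quot tproper_bideal).

Definition whole_algebra : based_algebra K :=
  @BasedAlgebra K talg fullv (vert T) tidem.

(* (1 - e_v) Lambda (1 - e_v) *)
Definition corner_algebra (v : vert T) : based_algebra K :=
  @BasedAlgebra K talg (<[1 - tidem v]> * fullv * <[1 - tidem v]>)%VS
    {x : vert T | x != v} (fun x => tidem (val x)).

End Triangular.

Section Hasse.
Variables (d : Order.disp_t) (S : finPOrderType d).
Local Open Scope order_scope.

Definition covers (s s' : S) : bool :=
  (s < s') && [forall z : S, ~~ ((s < z) && (z < s'))].

Definition smin : {set S} := [set s | [forall z : S, ~~ (z < s)]].
Definition smax : {set S} := [set s | [forall z : S, ~~ (s < z)]].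

Definition harr : finType := {p : S * S | covers p.1 p.2}.
Definition hhd (a : harr) : S := (val a).1.
Definition htl (a : harr) : S := (val a).2.

Lemma harr_lt a : hhd a < htl a.
Proof. by have /andP[] := valP a. Qed.

Lemma hwalk_le x w : walk hhd htl x w -> x <= wend htl x w.
Proof.
elim: w x => [|a w IH] x /=; first by rewrite /wend /=.
move=> /andP[/eqP <- /IH wP]; apply: le_trans (ltW (harr_lt a)) _.
exact: wP.
Qed.

Lemma hwalk_lt x w : walk hhd htl x w -> w != [::] -> x < wend htl x w.
Proof.
case: w => //= a w /andP[/eqP <- /hwalk_le wP] _.
exact: lt_le_trans (harr_lt a) wP.
Qed.

Lemma hasse_acyclic : acyclic hhd htl.
Proof.
move=> x w wP E; apply/eqP; apply: contraT => /(hwalk_lt wP).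
by rewrite E ltxx.
Qed.

Variable S0 : (0 < #|S|)%N.
Definition hasse : quiver := Quiver hasse_acyclic S0.

Lemma hwalk_smin x w : walk hhd htl x w -> wend htl x w \in smin -> w = [::].
Proof.
rewrite inE => wP /forallP/(_ x) xmin; apply/eqP; apply: contraNT xmin.
exact: hwalk_lt.
Qed.

Lemma hwalk_smax x w : walk hhd htl x w -> x \in smax -> w = [::].
Proof.
rewrite inE => wP /forallP/(_ (wend htl x w)) xmax.
by apply/eqP; apply: contraNT xmax; apply: hwalk_lt.
Qed.

Lemma hasse_parallel x w w' : walk hhd htl x w -> walk hhd htl x w' ->
  wend htl x w = wend htl x w' -> w <> w' -> (2 <= size w)%N.
Proof.
case: w => [|a [|b w]] //= wP w'P; rewrite /wend /=.
  by move=> E; case; rewrite (hasse_acyclic w'P (esym E)).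
move: wP w'P; rewrite andbT => /eqP <-; case: w' => [|b [|c w']] /=.
- by move=> _ E; move: (harr_lt a); rewrite E ltxx.
- rewrite andbT => /eqP hb tb; case; congr [:: _]; apply: val_inj.
  by move: hb tb; rewrite /hhd /htl; case: (val a) (val b) => [? ?] [? ?] /= -> ->.
move=> /and3P[/eqP hb /eqP hc w'P] E.
have /andP[_ /forallP/(_ (htl b)) /negP[]] := valP a; apply/andP; split.
  by rewrite -/(hhd a) -hb harr_lt.
rewrite -/(htl a) E -hc; apply: lt_le_trans (harr_lt c) _.
exact: (@hwalk_le (htl c) w').
Qed.

End Hasse.

Section Insertion.
Variables (K : fieldType) (T : triangular K) (v : vert T).
Variables (d : Order.disp_t) (S : finPOrderType d) (S0 : (0 < #|S|)%N).

Notation QS := (hasse S0).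

(* The sets of vertices and arrows of the inserted quiver are cut out of these by
   valid_vert and valid_arr; words of arrows are written with raw arrows. *)
Definition raw_vert : finType := (vert T + S)%type.
Definition raw_arr : finType := (arr T + arr QS + arr T * S + S * arr T)%type.

Definition old_vert (x : vert T) : raw_vert := inl x.
Definition new_vert (s : S) : raw_vert := inr s.
Definition old (a : arr T) : raw_arr := inl (inl (inl a)).
Definition new (a : arr QS) : raw_arr := inl (inl (inr a)).
Definition into (a : arr T) (s : S) : raw_arr := inl (inr (a, s)).
Definition outof (s : S) (b : arr T) : raw_arr := inr (s, b).

Definition valid_vert (x : raw_vert) : bool :=
  if x is inl x then x != v else true.

Definition valid_arr (a : raw_arr) : bool :=
  match a with
  | inl (inl (inl a)) => (hd a != v) && (tl a != v)
  | inl (inl (inr a)) => true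
  | inl (inr (a, s)) => (tl a == v) && (s \in smin S)
  | inr (s, b) => (hd b == v) && (s \in smax S)
  end.

Definition raw_hd (a : raw_arr) : raw_vert :=
  match a with
  | inl (inl (inl a)) => old_vert (hd a)
  | inl (inl (inr a)) => new_vert (hd a)
  | inl (inr (a, s)) => old_vert (hd a)
  | inr (s, b) => new_vert s
  end.

Definition raw_tl (a : raw_arr) : raw_vert :=
  match a with
  | inl (inl (inl a)) => old_vert (tl a)
  | inl (inl (inr a)) => new_vert (tl a)
  | inl (inr (a, s)) => new_vert s
  | inr (s, b) => old_vert (tl b)
  end.

Definition ins_vert : finType := {x : raw_vert | valid_vert x}.
Definition ins_arr : finType := {a : raw_arr | valid_arr a}.

Lemma no_loop (a : arr T) : hd a <> tl a.
Proof.
move=> E; have := @quiver_acyclic T (hd a) [:: a].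
by rewrite /= eqxx /wend /= E => /(_ isT erefl).
Qed.

Lemma valid_hd (a : ins_arr) : valid_vert (raw_hd (val a)).
Proof.
case: a => [[[[a|a]|[a s]]|[s b]]] //= /andP[] // /eqP tv _.
by apply/eqP => hv; apply: (@no_loop a); rewrite tv.
Qed.

Lemma valid_tl (a : ins_arr) : valid_vert (raw_tl (val a)).
Proof.
case: a => [[[[a|a]|[a s]]|[s b]]] //= /andP[] // /eqP hv _.
by apply/eqP => tv; apply: (@no_loop b); rewrite tv.
Qed.

Definition ins_hd (a : ins_arr) : ins_vert := exist valid_vert _ (valid_hd a).
Definition ins_tl (a : ins_arr) : ins_vert := exist valid_vert _ (valid_tl a).

(* Collapsing S to v sends walks of the inserted quiver to walks of Q. *)
Definition collapse_vert (x : raw_vert) : vert T := if x is inl x then x else v.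
Definition collapse_arr (a : raw_arr) : option (arr T) :=
  match a with
  | inl (inl (inl a)) => Some a
  | inl (inl (inr a)) => None
  | inl (inr (a, s)) => Some a
  | inr (s, b) => Some b
  end.

Lemma collapse_walk x w : walk ins_hd ins_tl x w ->
  let w' := pmap collapse_arr (map val w) in
  qwalk T (collapse_vert (val x)) w' /\
  qend T (collapse_vert (val x)) w' = collapse_vert (val (wend ins_tl x w)).
Proof.
elim: w x => [//|a w IH] x; rewrite [walk _ _ _ _]/= => /andP[/eqP <- /IH].
rewrite /wend /=; case: a => [[[[a|a]|[a s]]|[s b]]] //= va [P E]; split=> //.
- by rewrite eqxx.
- by have /andP[/eqP -> _] := va; rewrite eqxx.
- by have /andP[/eqP -> _] := va.
- by have /andP[-> _] := va.
Qed.

Lemma ins_walk_new x w : walk ins_hd ins_tl x w ->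
  pmap collapse_arr (map val w) = [::] -> w != [::] ->
  exists s s', [/\ val x = new_vert s, val (wend ins_tl x w) = new_vert s'
                 & (s < s')%O].
Proof.
elim: w x => [//|a w IH] x; rewrite [walk _ _ _ _]/= => /andP[/eqP <- wP].
case: a wP => [[[[a|a]|[a s]]|[s b]]] //= va wP w0 _.
exists (hhd a); case: (eqVneq w [::]) => [->|wN].
  by exists (htl a); split=> //; apply: harr_lt.
have [s [s' [es es' lt]]] := IH _ wP w0 wN.
exists s'; split=> //; move: es => [es].
by apply: lt_trans (harr_lt a) _; rewrite /htl; move: lt; rewrite -es.
Qed.

Lemma ins_acyclic : acyclic ins_hd ins_tl.
Proof.
move=> x w wP E; have [w'P E'] := collapse_walk wP.
move: E'; rewrite E => /(quiver_acyclic w'P) w0.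
apply/eqP; apply: contraT => /(ins_walk_new wP w0)[s [s' []]].
by rewrite E => -> [->]; rewrite ltxx.
Qed.

Lemma ins_nonempty : (0 < #|ins_vert|)%N.
Proof.
have /card_gt0P[s _] := S0.
by apply/card_gt0P; exists (exist valid_vert (new_vert s) isT).
Qed.

Definition ins_quiver : quiver := Quiver ins_acyclic ins_nonempty.

Notation KQ' := (path_alg K ins_quiver).

(* The path of the inserted quiver starting at x with word w; it is 0 when w is
   not the word of a path starting at x. *)
Definition pathw (x : raw_vert) (w : seq raw_arr) : KQ' :=
  [ffun r : qpath ins_quiver =>
     ((val (pstart r) == x) && (map val (parrows r) == w))%:R].

(* The word of (p, s), where p has word w. *)
Fixpoint set_last (w : seq (arr T)) (s : S) : seq raw_arr :=
  match w with
  | [::] => [::]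
  | [:: a] => [:: into a s]
  | a :: w' => old a :: set_last w' s
  end.

(* The word of (s, p), where p has word w. *)
Definition set_first (s : S) (w : seq (arr T)) : seq raw_arr :=
  if w is b :: w' then outof s b :: map old w' else [::].

(* u is one of the possible choices for the path "p tilde". *)
Definition is_tilde (p : qpath T) (u : KQ') : Prop :=
  (v \notin pstart p :: map (@tl T) (parrows p) /\
   u = pathw (old_vert (pstart p)) (map old (parrows p))) \/
  (exists w1 w2 s q,
    [/\ parrows p = w1 ++ w2, qend T (pstart p) w1 = v
      & [/\ qwalk QS s q, s \in smin S, qend QS s q \in smax S
      & u = pathw (old_vert (pstart p))
              (set_last w1 s ++ map new q ++ set_first (qend QS s q) w2)]]).

Notation KQ := (path_alg K T).

(* The generators of the ideal of the insertion.  In ins_rel_1a and ins_rel_1b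
   the trivial path at v never contributes, as f has no coefficient on it. *)
Inductive ins_rel : KQ' -> Prop :=
| ins_rel_1a (f : KQ) i s :
    f \in tideal T -> supported_from_to i v f -> s \in smin S ->
    ins_rel (\sum_p pcoef f p *:
               pathw (old_vert (pstart p)) (set_last (parrows p) s))
| ins_rel_1b (f : KQ) j s :
    f \in tideal T -> supported_from_to v j f -> s \in smax S ->
    ins_rel (\sum_p pcoef f p *: pathw (new_vert s) (set_first s (parrows p)))
| ins_rel_2a s q1 q2 :
    qwalk QS s q1 -> qwalk QS s q2 -> qend QS s q1 = qend QS s q2 ->
    ins_rel (pathw (new_vert s) (map new q1) - pathw (new_vert s) (map new q2))
| ins_rel_2b a s1 q1 s2 q2 :
    tl a = v -> qwalk QS s1 q1 -> qwalk QS s2 q2 ->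
    s1 \in smin S -> s2 \in smin S -> qend QS s1 q1 = qend QS s2 q2 ->
    ins_rel (pathw (old_vert (hd a)) (into a s1 :: map new q1) -
             pathw (old_vert (hd a)) (into a s2 :: map new q2))
| ins_rel_2c b s q1 q2 :
    hd b = v -> qwalk QS s q1 -> qwalk QS s q2 ->
    qend QS s q1 \in smax S -> qend QS s q2 \in smax S ->
    ins_rel (pathw (new_vert s) (rcons (map new q1) (outof (qend QS s q1) b)) -
             pathw (new_vert s) (rcons (map new q2) (outof (qend QS s q2) b)))
| ins_rel_2d a b s1 q1 s2 q2 :
    tl a = v -> hd b = v -> qwalk QS s1 q1 -> qwalk QS s2 q2 ->
    s1 \in smin S -> s2 \in smin S ->
    qend QS s1 q1 \in smax S -> qend QS s2 q2 \in smax S ->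
    ins_rel (pathw (old_vert (hd a))
               (into a s1 :: rcons (map new q1) (outof (qend QS s1 q1) b)) -
             pathw (old_vert (hd a))
               (into a s2 :: rcons (map new q2) (outof (qend QS s2 q2) b)))
| ins_rel_3 (f : KQ) i j (tilde : qpath T -> KQ') :
    f \in tideal T -> supported_from_to i j f -> i != v -> j != v ->
    (forall p, pcoef f p != 0 -> is_tilde p (tilde p)) ->
    ins_rel (\sum_p pcoef f p *: tilde p).

Definition ins_ideal : {vspace KQ'} := ideal_gen ins_rel.

Definition raw_end (x : raw_vert) (w : seq raw_arr) := last x (map raw_tl w).

Lemma raw_endP (r : qpath ins_quiver) :
  val (pend r) = raw_end (val (pstart r)) (map val (parrows r)).
Proof.
rewrite /pend /raw_end /wend; elim: (parrows r) (pstart r) => //=.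
Qed.

Lemma pathw_neq0 x w r : pcoef (pathw x w) r != 0 ->
  val (pstart r) = x /\ map val (parrows r) = w.
Proof.
by rewrite /pcoef ffunE; case: andP => [[/eqP -> /eqP ->]|]; rewrite ?eqxx.
Qed.

Lemma pcoef_sumZ (I : finType) (c : I -> K) (u : I -> KQ') r :
  pcoef (\sum_i c i *: u i) r != 0 ->
  exists i, c i != 0 /\ pcoef (u i) r != 0.
Proof.
move=> nz; suff [i] : exists i, c i * pcoef (u i) r != 0.
  by rewrite mulf_eq0 => /norP[? ?]; exists i.
apply/existsP; apply: contraNT nz => /existsPn z.
rewrite (_ : pcoef _ r = \sum_i c i * pcoef (u i) r).
  by rewrite big1 // => i _; have /negPn/eqP := z i.
by rewrite /pcoef sum_ffunE; apply: eq_bigr => i _; rewrite ffunE.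
Qed.

Lemma pcoefB_neq0 (f g : KQ') r : f <> g -> pcoef (f - g) r != 0 ->
  pcoef f r != 0 \/ pcoef g r != 0.
Proof.
move=> _; rewrite /pcoef ffunE ffunE.
case: (eqVneq ((f : {ffun _ -> K^o}) r) 0) => [->|]; last by left.
by rewrite add0r oppr_eq0; right.
Qed.

Lemma is_relation_words (g : KQ') x y :
  (forall r, pcoef g r != 0 -> exists w,
    [/\ pcoef (pathw x w) r != 0, (2 <= size w)%N & raw_end x w = y]) ->
  is_relation g.
Proof.
move=> gP; split; last first.
  by move=> r /gP[w [/pathw_neq0[_ <-]]]; rewrite size_map.
case: (pselect (exists r0, pcoef g r0 != 0)) => [[r0 nz0]|nz].
  exists (pstart r0), (pend r0) => r nz; split; apply: val_inj.
    have [? [/pathw_neq0[-> _] _ _]] := gP _ nz.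
    by have [? [/pathw_neq0[-> _] _ _]] := gP _ nz0.
  rewrite !raw_endP.
  have [w [/pathw_neq0[-> ->] _ ->]] := gP _ nz.
  by have [w0 [/pathw_neq0[-> ->] _ ->]] := gP _ nz0.
have /card_gt0P[i _] := ins_nonempty.
by exists i, i => r rnz; case: nz; exists r.
Qed.

Lemma is_relation0 : is_relation (0 : KQ').
Proof.
by apply: (@is_relation_words _ (old_vert v) (old_vert v)) => r; rewrite pcoef0 eqxx.
Qed.

Lemma is_relationB x y w w' : (w <> w' -> (2 <= size w)%N /\ (2 <= size w')%N) ->
  raw_end x w = y -> raw_end x w' = y -> is_relation (pathw x w - pathw x w').
Proof.
move=> sz e e'; case: (eqVneq w w') => [->|/eqP /sz[? ?]].
  by rewrite subrr; apply: is_relation0.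
apply: (@is_relation_words _ x y) => r.
case: (eqVneq (pathw x w) (pathw x w')) => [->|/eqP ne].
  by rewrite subrr pcoef0 eqxx.
by case/(pcoefB_neq0 ne) => nz; [exists w | exists w'].
Qed.

Lemma size_set_last w s : size (set_last w s) = size w.
Proof. by elim: w => [|a [|b w] IH] //=; rewrite IH. Qed.

Lemma size_set_first s w : size (set_first s w) = size w.
Proof. by case: w => //= b w; rewrite size_map. Qed.

Lemma raw_end_cat x w w' : raw_end x (w ++ w') = raw_end (raw_end x w) w'.
Proof. by rewrite /raw_end map_cat last_cat. Qed.

Lemma raw_end_set_last x w s : w != [::] -> raw_end x (set_last w s) = new_vert s.
Proof.
by elim: w x => [|a [|b w] IH] //= x _; apply: (IH (old_vert (tl a))).
Qed.

Lemma raw_end_old x w : raw_end (old_vert x) (map old w) = old_vert (qend T x w).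
Proof. by rewrite /raw_end /wend; elim: w x => //= a w IH x; apply: IH. Qed.

Lemma raw_end_new s q : raw_end (new_vert s) (map new q) = new_vert (qend QS s q).
Proof. by rewrite /raw_end /wend; elim: q s => //= a w IH x; apply: IH. Qed.

Lemma raw_end_set_first x y s w : w != [::] ->
  raw_end x (set_first s w) = old_vert (qend T y w).
Proof. by case: w => //= b w _; apply: raw_end_old. Qed.

Lemma long_neq0 (w : seq (arr T)) : (2 <= size w)%N -> w != [::].
Proof. by case: w. Qed.

Lemma ins_rel_is_relation (g : KQ') : ins_rel g -> is_relation g.
Proof.
case=> {g}.
- move=> f i s fI fs _; apply: (@is_relation_words _ (old_vert i) (new_vert s)) => r.
  case/pcoef_sumZ => p [pnz]; have [-> _] := fs _ pnz => rnz.
  have sz := tideal_long fI pnz.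
  exists (set_last (parrows p) s).
  by rewrite size_set_last raw_end_set_last ?long_neq0.
- move=> f j s fI fs _; apply: (@is_relation_words _ (new_vert s) (old_vert j)) => r.
  case/pcoef_sumZ => p [pnz rnz]; have sz := tideal_long fI pnz.
  exists (set_first s (parrows p)).
  rewrite size_set_first (raw_end_set_first _ (pstart p)) ?long_neq0 //.
  by have [_ <-] := fs _ pnz.
- move=> s q1 q2 P1 P2 E; apply: is_relationB; last 2 first.
  + exact: raw_end_new.
  + by rewrite raw_end_new E.
  move=> ne; rewrite !size_map.
  have ne' : q1 <> q2 by move=> e; apply: ne; rewrite e.
  by split; [apply: hasse_parallel P1 P2 E ne'
            | apply: hasse_parallel P2 P1 (esym E) (nesym ne')].
- move=> a s1 q1 s2 q2 ta P1 P2 m1 m2 E; apply: is_relationB; last 2 first.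
  + exact: (raw_end_new s1 q1).
  + by rewrite E; apply: (raw_end_new s2 q2).
  move=> ne; have ne' : q1 <> [::] /\ q2 <> [::].
    split=> e; apply: ne; subst.
      have e2 := hwalk_smin P2; rewrite -E in e2; have e := e2 m1.
      by subst; move: E; rewrite /wend /= => ->.
    have e1 := hwalk_smin P1; rewrite E in e1; have e := e1 m2.
    by subst; move: E; rewrite /wend /= => ->.
  by case: ne' => /eqP + /eqP; case: (q1) (q2) => [|? ?] [|? ?].
- move=> b s q1 q2 hb P1 P2 m1 m2.
  apply: (@is_relationB _ (old_vert (tl b))); last 2 first.
  + by rewrite -cats1 raw_end_cat.
  + by rewrite -cats1 raw_end_cat.
  move=> ne; have ne' : q1 <> [::] /\ q2 <> [::].
    split=> e; apply: ne; subst.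
      by rewrite (hwalk_smax P2 m1).
    by rewrite (hwalk_smax P1 m2).
  by case: ne' => /eqP + /eqP; case: (q1) (q2) => [|? ?] [|? ?]; rewrite //= !size_rcons.
- move=> a b s1 q1 s2 q2 ta hb P1 P2 m1 m2 M1 M2.
  apply: (@is_relationB _ (old_vert (tl b))).
  + by rewrite /= !size_rcons.
  + by rewrite -cats1 -cat_cons raw_end_cat.
  + by rewrite -cats1 -cat_cons raw_end_cat.
move=> f i j tilde fI fs iv jv tP.
apply: (@is_relation_words _ (old_vert i) (old_vert j)) => r.
case/pcoef_sumZ => p [pnz]; have [si ej] := fs _ pnz.
have sz := tideal_long fI pnz.
case: (tP _ pnz) => [[_ ->]|[w1 [w2 [s [q [aE e1 [qP sm qm ->]]]]]]].
  rewrite si => rnz; exists (map old (parrows p)).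
  by split=> //; rewrite ?size_map // raw_end_old -si -ej.
rewrite si => rnz; eexists; split; first exact: rnz.
  rewrite !size_cat size_set_last size_set_first size_map addnCA.
  by rewrite -size_cat -aE (leq_trans sz) // leq_addl.
have w2N : w2 != [::].
  apply: contraNN jv => /eqP w20; move: aE ej; rewrite w20 cats0 /pend => -> <-.
  by rewrite e1.
rewrite !raw_end_cat (raw_end_set_first _ v) // -ej /pend aE.
by rewrite wend_cat e1.
Qed.

Definition insertion : triangular K :=
  @Triangular K ins_quiver ins_ideal
    (ex_intro2 _ _ ins_rel ins_rel_is_relation erefl).

End Insertion.

Section Sequence.
Variables (K : fieldType) (T : triangular K) (v : vert T).

Lemma chain_nonempty i : (0 < #|'I_i.+1|)%N.
Proof. by rewrite card_ord. Qed.

Definition chain_insertion i : triangular K :=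
  insertion v (S := 'I_i.+1) (chain_nonempty i).

(* The insertion of a one-element chain is identified with T itself, hence the
   separate case i = 1; note that chain_insertion i' inserts i'.+1 elements. *)
Definition chain_sequence (i : nat) : based_algebra K :=
  match i with
  | 0 => corner_algebra v
  | 1 => whole_algebra T
  | i'.+1 => whole_algebra (chain_insertion i')
  end.

End Sequence.

Definition degree (p : {poly int}) : nat := (size p).-1.

(* Main.v *)
From HB Require Import structures.
Require Import Defs.
From mathcomp Require Import all_boot all_order all_fingroup all_algebra all_field.
From mathcomp Require Import boolp ring.
Set Implicit Arguments.
Unset Strict Implicit.
Unset Printing Implicit Defensive.
Import Order.TTheory GRing.Theory Num.Theory.
Local Open Scope ring_scope.

(** Let e_x be the idempotent of the vertex x. A homomorphism from P_i to P_j is the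
    left multiplication by an element of e_j Lambda e_i (dim_module_hom), so the
    entry (i, j) of the Cartan matrix C is the dimension of the span of the paths
    from j to i, and it does not change when one passes to a corner that contains
    both idempotents.

    These dimensions survive the insertion of a chain at v. Contracting the chain to
    v sends the paths of the inserted quiver to paths of Q. From every element of a
    chain there is only one way upwards, so a path is determined by its endpoints
    and its contraction (collapse_word_inj); conversely every path of Q lifts, and
    the relations of Lambda lift to the relations that define the insertion
    (lift_ex). The contraction is not an algebra morphism, but it is multiplicative
    on products that meet in one vertex, which is enough to see that it maps the
    ideal of the insertion into that of Lambda (path_push_ideal). Hence two spaces
    of paths with corresponding endpoints have the same dimension modulo the
    relations (hdim_insertion), unless the endpoints are chain elements in
    decreasing order, when there is no path (hdim_insertion0).

    So, with respect to the vertices outside the chain, every element of the chain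
    has the entries that v has in C, and within the chain C is a triangle of ones.
    In xC + C^T the rows of the two smallest elements of the chain then differ only
    in two entries, and so do their columns. Subtracting one from the other and
    expanding the determinant gives the recurrence (fdet_chain); deleting the
    smallest element, or the two smallest ones, leaves the matrices of the two
    previous algebras.

    As Q has no oriented cycle, C is unitriangular for a suitable order of the
    vertices (det_unitriangular with reach_rank), and det C = 1 makes det(xC + C^T)
    a polynomial whose degree is the number of vertices (size_det_coxeter). This
    gives the degrees for the first two algebras; in the recurrence the term
    (x + 1) phi has the larger degree, which gives the others. *)

(** * Determinants indexed by finite types *)

Section IndexedDeterminant.
Variable R : comNzRingType.

(** The Cartan matrices are given by an arbitrary enumeration of the vertices;
    indexing by the vertices themselves lets a bijection replace the vertex set. *)
Definition fdet (I : finType) (f : I -> I -> R) : R :=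
  \det (\matrix_(i < #|I|, j < #|I|) f (enum_val i) (enum_val j)).

Lemma fdet_ord (I : finType) (f : I -> I -> R) n (h : 'I_n -> I) :
  bijective h -> fdet f = \det (\matrix_(i, j) f (h i) (h j)).
Proof.
move=> bh; have nE : n = #|I|.
  by rewrite -[LHS](card_ord n); apply: bij_eq_card bh.
subst n; rewrite /fdet.
have inj_s : injective (fun i => enum_rank (h i)).
  by move=> i j /enum_rank_inj /(bij_inj bh).
pose A : 'M[R]_#|I| := \matrix_(i, j) f (enum_val i) (enum_val j).
rewrite -/A; have -> : \matrix_(i, j) f (h i) (h j)
    = row_perm (perm inj_s) (col_perm (perm inj_s) A).
  by apply/matrixP => i j; rewrite !mxE !permE !enum_rankK.
rewrite row_permE col_permE !det_mulmx !det_perm [\det A * _]mulrC mulrA.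
by rewrite odd_permV -signr_addb addbb mul1r.
Qed.

Lemma fdet_bij (I J : finType) (f : I -> I -> R) (h : J -> I) :
  bijective h -> fdet f = fdet (fun i j => f (h i) (h j)).
Proof.
move=> bh; rewrite (@fdet_ord I f #|J| (h \o enum_val)) //.
exact: bij_comp bh (enum_val_bij J).
Qed.

Lemma eq_fdet (I : finType) (f g : I -> I -> R) : f =2 g -> fdet f = fdet g.
Proof. by move=> fg; congr (\det _); apply/matrixP => i j; rewrite !mxE fg. Qed.

(** Rows 0 and 1 agree beyond the second entry, and so do columns 0 and 1.
    Subtracting row 1 from row 0 and column 1 from column 0 leaves only
    [t, - x] in the first row and [t; - 1] in the first column; expanding along
    them gives a three-term recurrence. *)
Lemma det_chain_step k (t x : R) (r : 'rV[R]_k) (c : 'cV[R]_k) (N : 'M[R]_k) :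
  t = x + 1 ->
  \det (block_mx t%:M (row_mx 1%:M r) (col_mx x%:M c) (block_mx t%:M r c N)
        : 'M_(1 + (1 + k)))
  = t * \det (block_mx t%:M r c N : 'M_(1 + k)) - x * \det N.
Proof.
move=> tE; set M := block_mx t%:M (row_mx 1%:M r) _ _.
pose N1 : 'M_(1 + k) := block_mx t%:M r c N.
(* Multiplication by E and F performs the row and the column subtraction. *)
pose E : 'M[R]_(1 + (1 + k)) := block_mx 1%:M (row_mx (- 1%:M) 0) 0 1%:M.
pose F : 'M[R]_(1 + (1 + k)) := block_mx 1%:M 0 (col_mx (- 1%:M) 0) 1%:M.
have -> : \det M = \det (E *m M *m F).
  by rewrite !det_mulmx det_ublock det_lblock !det1 !mul1r !mulr1.
have -> : E *m M *m F =
    block_mx t%:M (row_mx (- x%:M) 0) (col_mx (- 1%:M) 0) N1.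
  rewrite /E /M /F !mulmx_block !(mul0mx, mulmx0, mul1mx, mulmx1, addr0, add0r).
  rewrite /N1 !mul_row_block !mul_row_col !mul_block_col.
  rewrite !(mul0mx, mulmx0, mul1mx, mulmx1, addr0, add0r, mulNmx, mulmxN).
  rewrite -/N1 !add_row_mx !add_col_mx !subrr.
  rewrite mul_row_col mul0mx addr0 mulmxN mulmx1 tE.
  congr (block_mx _ (row_mx _ _) (col_mx _ _) _).
  - by apply/matrixP => i j; rewrite !mxE !ord1 eqxx !mulr1n; ring.
  - by apply/matrixP => i j; rewrite !mxE !ord1 eqxx !mulr1n; ring.
  - by apply/matrixP => i j; rewrite !mxE !ord1 eqxx !mulr1n; ring.
set D := block_mx _ _ _ N1.
have e0 : (ord0 : 'I_(1 + (1 + k))) = lshift (1 + k) (ord0 : 'I_1) by exact: ord_inj.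
have e1 : lift ord0 ord0 = rshift 1 (lshift k (ord0 : 'I_1)) :> 'I_(1 + (1 + k)).
  exact: ord_inj.
have e2 i : lift ord0 (lift ord0 i) = rshift 1 (rshift 1 i) :> 'I_(1 + (1 + k)).
  exact: ord_inj.
rewrite (expand_det_row D ord0) (@big_ord_recl _ _ _ (1 + k)) (@big_ord_recl _ _ _ k).
rewrite big1 ?addr0 => [|i _]; last first.
  by rewrite e2 e0 block_mxEur row_mxEr mxE mul0r.
rewrite [X in X * _ + _](_ : _ = t); last first.
  by rewrite e0 block_mxEul mxE eqxx.
rewrite [X in _ + X * _](_ : _ = - x); last first.
  by rewrite e1 e0 block_mxEur row_mxEl !mxE eqxx.
rewrite /cofactor mul1r expr1 mulN1r.
have l0 (i : 'I_(1 + k)) : lift ord0 i = rshift 1 i :> 'I_(1 + (1 + k)).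
  exact: ord_inj.
have -> : row' ord0 (col' ord0 D) = N1.
  apply/matrixP => i j; rewrite [LHS]mxE [LHS]mxE !l0.
  exact: (@block_mxEdr _ 1 (1 + k) 1 (1 + k)).
have -> : row' ord0 (col' (lift ord0 ord0) D) = block_mx (- 1%:M) r 0 N.
  apply/matrixP => i; change 'I_(1 + k) in i => j; change 'I_(1 + k) in j.
  rewrite [LHS]mxE [LHS]mxE l0.
  case: (splitP j) => j' Ej.
    have -> : lift (lift ord0 ord0) j = lshift (1 + k) j'.
      by apply: ord_inj; rewrite /= Ej ord1.
    have -> : j = lshift k j' by apply: ord_inj.
    rewrite [LHS](@block_mxEdl _ 1 (1 + k) 1 (1 + k)); case: (splitP i) => i' Ei.
      have -> : i = lshift k i' by apply: ord_inj.
      by rewrite [LHS](@col_mxEu _ 1 k) [RHS](@block_mxEul _ 1 k 1 k).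
    have -> : i = rshift 1 i' by apply: ord_inj.
    by rewrite [LHS](@col_mxEd _ 1 k) [RHS](@block_mxEdl _ 1 k 1 k).
  have -> : lift (lift ord0 ord0) j = rshift 1 j by apply: ord_inj; rewrite /= Ej.
  have -> : j = rshift 1 j' by apply: ord_inj.
  rewrite [LHS](@block_mxEdr _ 1 (1 + k) 1 (1 + k)); case: (splitP i) => i' Ei.
    have -> : i = lshift k i' by apply: ord_inj.
    by rewrite [LHS](@block_mxEur _ 1 k 1 k) [RHS](@block_mxEur _ 1 k 1 k).
  have -> : i = rshift 1 i' by apply: ord_inj.
  by rewrite [LHS](@block_mxEdr _ 1 k 1 k) [RHS](@block_mxEdr _ 1 k 1 k).
by rewrite (@det_ublock _ 1) det_mx11 !mxE eqxx mulN1r opprK mulNr.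
Qed.

(** Adjoining a new first index: the enumeration that sends 0 to None. *)
Definition ord_ext (I : finType) n (h : 'I_n -> I) (i : 'I_(1 + n)) : option I :=
  if split i is inr k then Some (h k) else None.

Lemma ord_ext_bij (I : finType) n (h : 'I_n -> I) :
  bijective h -> bijective (ord_ext h).
Proof.
case=> g gK hK.
exists (fun o => if o is Some z then rshift 1 (g z) else lshift n ord0).
  move=> i; rewrite /ord_ext -{2}[i]splitK.
  by case: (split i) => k /=; rewrite ?gK ?ord1.
case=> [z|]; rewrite /ord_ext.
  by rewrite -[rshift 1 _]/(unsplit (inr _)) unsplitK hK.
by rewrite -[lshift n _]/(unsplit (inl _)) unsplitK.
Qed.

Lemma ord_extl (I : finType) n (h : 'I_n -> I) k : ord_ext h (lshift n k) = None.
Proof. by rewrite /ord_ext -[lshift n _]/(unsplit (inl _)) unsplitK. Qed.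

Lemma ord_extr (I : finType) n (h : 'I_n -> I) k :
  ord_ext h (rshift 1 k) = Some (h k).
Proof. by rewrite /ord_ext -[rshift 1 _]/(unsplit (inr _)) unsplitK. Qed.

Lemma matrix_ord_ext (I : finType) n (h : 'I_n -> I) (f : option I -> option I -> R) :
  \matrix_(i, j) f (ord_ext h i) (ord_ext h j) =
  block_mx (f None None)%:M (\row_j f None (Some (h j)))
           (\col_i f (Some (h i)) None) (\matrix_(i, j) f (Some (h i)) (Some (h j))).
Proof.
apply/matrixP => i j; rewrite mxE -[i]splitK -[j]splitK.
case: (split i) => i'; case: (split j) => j' /=.
- by rewrite block_mxEul !ord_extl !ord1 mxE.
- by rewrite block_mxEur ord_extl ord_extr mxE.
- by rewrite block_mxEdl ord_extl ord_extr mxE.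
- by rewrite block_mxEdr !ord_extr mxE.
Qed.

(** None and Some None play the parts of the two smallest elements of a chain:
    both have the same entries with every other index. *)
Lemma fdet_chain (I : finType) (f : option (option I) -> option (option I) -> R) x :
  f None None = x + 1 -> f (Some None) (Some None) = x + 1 ->
  f None (Some None) = 1 -> f (Some None) None = x ->
  (forall z, f None (Some (Some z)) = f (Some None) (Some (Some z))) ->
  (forall z, f (Some (Some z)) None = f (Some (Some z)) (Some None)) ->
  fdet f = (x + 1) * fdet (fun i j => f (Some i) (Some j))
           - x * fdet (fun i j => f (Some (Some i)) (Some (Some j))).
Proof.
move=> f00 f11 f01 f10 fr fc; have bh := enum_val_bij I.
rewrite (fdet_ord _ (ord_ext_bij (ord_ext_bij bh))).
rewrite (fdet_ord _ (ord_ext_bij bh)) (fdet_ord _ bh) !matrix_ord_ext f00.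
rewrite (matrix_ord_ext _ (fun i j => f (Some i) (Some j))) f11.
rewrite -(det_chain_step _ _ _ erefl); congr (\det (block_mx _ _ _ _)).
  apply/matrixP => i j; rewrite mxE -[j]splitK.
  case: (split j) => j' /=; first by rewrite row_mxEl ord_extl !ord1 mxE f01.
  by rewrite row_mxEr ord_extr mxE fr.
apply/matrixP => i j; rewrite mxE -[i]splitK.
case: (split i) => i' /=; first by rewrite col_mxEu ord_extl !ord1 mxE f10.
by rewrite col_mxEd ord_extr mxE fc.
Qed.

(** In the Leibniz formula a nonzero term comes from a permutation that never
    lowers the rank, and raises it at each point it moves; as the total rank is
    preserved, only the identity contributes. *)
Lemma det_unitriangular n (A : 'M[R]_n) (rk : 'I_n -> nat) :
  (forall i, A i i = 1) ->
  (forall i j, i != j -> A i j != 0 -> (rk i < rk j)%N) -> \det A = 1.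
Proof.
move=> A1 Ark; rewrite /determinant (bigD1 1%g) //= odd_perm1 mul1r.
have -> : \prod_i A i ((1%g : 'S_n) i) = 1 by apply: big1 => i _; rewrite perm1.
rewrite big1 ?addr0 // => s s1.
case: (pickP (fun i => A i (s i) == 0)) => [i /eqP Ai|nz].
  by rewrite (bigD1 i) //= Ai mul0r mulr0.
case: (pickP (fun i => s i != i)) => [i0 si0|s1']; last first.
  by case/eqP: s1; apply/permP => i; rewrite perm1; apply/eqP/negPn/negbT/s1'.
(* If all factors were nonzero, s would increase the total rank. *)
suff: (\sum_i rk i < \sum_i rk (s i))%N.
  rewrite [X in (_ < X)%N](_ : _ = \sum_i rk i)%N ?ltnn //.
  by rewrite [RHS](reindex_inj (@perm_inj _ s)).
rewrite (bigD1 i0) //= [X in (_ < X)%N](bigD1 i0) //= -addSn leq_add //.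
  by rewrite Ark ?nz // eq_sym.
apply: leq_sum => i _; case: (eqVneq i (s i)) => [<- //|isi].
by rewrite ltnW // Ark // nz.
Qed.

End IndexedDeterminant.

(** Since C is invertible of determinant 1, the polynomial det(x C + C^T) is the
    characteristic polynomial of - C^-1 C^T. *)
Lemma size_det_coxeter n (C : 'M[int]_n) : \det C = 1 ->
  size (\det ('X *: map_mx polyC C + (map_mx polyC C)^T)) = n.+1.
Proof.
move=> C1; have uC : C \in unitmx by rewrite unitmxE C1 unitr1.
rewrite -(size_char_poly (- (invmx C *m C^T))) /char_poly /char_poly_mx.
congr (size (polyseq _)).
rewrite -[RHS]mul1r -(rmorph1 (@polyC int)) -C1 -det_map_mx -det_mulmx.
congr (\det _); rewrite mulmxBr mul_mx_scalar; congr (_ + _).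
by rewrite map_mxN mulmxN opprK map_mxM mulmxA -map_mxM mulmxV // map_mx1 mul1mx map_trmx.
Qed.

(** * Homomorphisms between projective modules *)

Section Hom.
Variables (K : fieldType) (L : falgType K).

Lemma mem_lmul (e : L) (B : {vspace L}) u :
  reflect (exists2 b, b \in B & u = e * b) (u \in (<[e]> * B)%VS).
Proof.
apply: (iffP idP) => [|[b bB ->]]; last by rewrite memv_mul ?memv_line.
suff /subvP sub : (<[e]> * B <= amull e @: B)%VS.
  by move/sub/memv_imgP=> [b bB ->]; exists b => //; rewrite lfunE.
apply/prodvP => _ b /vlineP[k ->] bB; rewrite -scalerAl rpredZ //.
by apply/memv_imgP; exists b => //; rewrite lfunE.
Qed.

Lemma mem_rmul (e : L) (B : {vspace L}) u :
  reflect (exists2 b, b \in B & u = b * e) (u \in (B * <[e]>)%VS).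
Proof.
rewrite -limg_amulr; apply: (iffP memv_imgP) => -[b bB ->]; exists b => //;
  by rewrite lfunE.
Qed.

Lemma mem_sandwich (e e' : L) (B : {vspace L}) u :
  reflect (exists2 b, b \in B & u = e * b * e') (u \in (<[e]> * B * <[e']>)%VS).
Proof.
apply: (iffP (mem_rmul _ _ _)) => [[_ /mem_lmul[b bB ->] ->]|[b bB ->]].
  by exists b.
by exists (e * b) => //; apply/mem_lmul; exists b.
Qed.

(** A homomorphism from e1 B is determined by the image w = w e1 of e1, and is then
    the left multiplication by w. *)
Lemma dim_module_hom (B : {vspace L}) (e1 e2 : L) :
  e1 \in B -> e1 * e1 = e1 -> {in B &, forall b c, b * c \in B} ->
  \dim (module_hom B (<[e1]> * B)%VS (<[e2]> * B)%VS) =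
  \dim (<[e2]> * B * <[e1]>)%VS.
Proof.
move=> e1B ee BM; set U := (<[e1]> * B)%VS; set W := (<[e2]> * B)%VS.
have e1U : e1 \in U by apply/mem_lmul; exists e1.
pose u1 : subvs_of U := Subvs e1U.
(* Evaluation at e1 will be injective with image e2 B e1. *)
pose ev (f : 'Hom(subvs_of U, subvs_of W)) : L := vsval (f u1).
have ev_lin : linear ev.
  by move=> a f g; rewrite /ev add_lfunE scale_lfunE linearP.
pose evL := GRing.isLinear.Build _ _ _ _ ev ev_lin.
pose evl : {linear 'Hom(subvs_of U, subvs_of W) -> L} := HB.pack ev evL.
have evE f : linfun evl f = vsval (f u1) by rewrite lfunE.
have homE f u b : f \in module_hom B U W -> b \in B -> vsval u = e1 * b ->
    vsval (f u) = vsval (f u1) * b.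
  by move=> /module_homP fP bB ub; apply: fP.
rewrite -(@limg_dim_eq _ _ _ (linfun evl)); last first.
  apply/eqP; rewrite -subv0; apply/subvP => f; rewrite memv_cap memv_ker evE memv0.
  case/andP=> fP /eqP f1; apply/eqP/lfunP => u; apply: val_inj.
  have /mem_lmul[b bB ub] := subvsP u.
  by apply: (etrans (homE _ _ _ fP bB ub)); rewrite f1 mul0r lfunE.
congr (\dim _); apply/eqP; rewrite eqEsubv; apply/andP; split; apply/subvP => w.
  case/memv_imgP=> f fP ->; rewrite evE.
  have /mem_lmul[b bB fb] := subvsP (f u1).
  apply/mem_sandwich; exists b => //; rewrite -fb.
  by apply: homE => //; rewrite ee.
case/mem_sandwich=> b bB ->; set w0 := e2 * b * e1.
have w0U (u : subvs_of U) : w0 * vsval u \in W.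
  have /mem_lmul[c cB ->] := subvsP u; apply/mem_lmul.
  by exists (b * e1 * (e1 * c)); rewrite ?BM // /w0 !mulrA.
pose g (u : subvs_of U) : subvs_of W := vsproj W (w0 * vsval u).
have g_lin : linear g by move=> a u u'; rewrite /g linearP mulrDr -scalerAr linearP.
pose gL := GRing.isLinear.Build _ _ _ _ g g_lin.
pose gl : {linear subvs_of U -> subvs_of W} := HB.pack g gL.
have glE u : vsval (linfun gl u) = w0 * vsval u by rewrite lfunE /= vsprojK.
apply/memv_imgP; exists (linfun gl).
  by apply/module_homP => u u' c cB uc; rewrite !glE uc mulrA.
by rewrite evE glE /= /w0 -!mulrA ee.
Qed.

End Hom.

(** * Path algebras *)

Section PathBasis.
Variables (K : fieldType) (Q : quiver).
Notation KQ := (path_alg K Q).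
Implicit Types (p q r : qpath Q) (f g : KQ).

Definition pdelta p : KQ := [ffun q => (q == p)%:R].

Lemma pcoef_delta p q : pcoef (pdelta p) q = (q == p)%:R.
Proof. by rewrite /pcoef ffunE. Qed.

Lemma pcoef_sum (I : Type) (s : seq I) (P : pred I) (F : I -> KQ) r :
  pcoef (\sum_(i <- s | P i) F i) r = \sum_(i <- s | P i) pcoef (F i) r.
Proof. by rewrite /pcoef sum_ffunE. Qed.

Lemma pdelta_sum f : f = \sum_p pcoef f p *: pdelta p.
Proof.
apply: pcoefP => q; rewrite pcoef_sum (bigD1 q) //= big1 => [|p pq].
  by rewrite pcoefZ pcoef_delta eqxx mulr1 addr0.
by rewrite pcoefZ pcoef_delta eq_sym (negPf pq) mulr0.
Qed.

Lemma pmulE f g : f * g = path_mul f g. Proof. by []. Qed.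

Lemma pdeltaM p q r : is_comp p q r -> pdelta p * pdelta q = pdelta r.
Proof.
move=> cpqr; apply: pcoefP => u; rewrite pmulE pcoef_mul pcoef_delta.
transitivity ((is_comp p q u)%:R : K).
  rewrite (bigD1 p) //= [X in _ + X]big1 ?addr0 => [|p' pp']; last first.
    by rewrite big1 // => q' _; rewrite pcoef_delta (negPf pp') mul0r.
  under eq_bigr do rewrite !pcoef_delta eqxx mul1r.
  case: (boolP (is_comp p q u)) => [c|nc].
    rewrite (bigD1 q) //= eqxx big1 ?addr0 // => q' /andP[_ qq'].
    by rewrite (negPf qq').
  by rewrite big1 // => q' c; case: eqP => // e; rewrite -e c in nc.
congr (_%:R); congr (nat_of_bool _); apply/idP/eqP => [|->//].
case/and3P: cpqr => /eqP rs _ /eqP ra /and3P[/eqP us _ /eqP ua].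
by apply: qpath_inj; rewrite ?us ?ua.
Qed.

Lemma pdeltaM0 p q : pend p != pstart q -> pdelta p * pdelta q = 0.
Proof.
move=> npq; apply: pcoefP => u; rewrite pmulE pcoef_mul pcoef0.
rewrite big1 // => p' _; rewrite big1 // => q' /and3P[_ /eqP c _].
rewrite !pcoef_delta; case: eqP => [pp'|]; last by rewrite mul0r.
case: eqP => [qq'|]; last by rewrite mulr0.
by rewrite -pp' -qq' c eqxx in npq.
Qed.

Lemma comp_ex p q : pend p = pstart q -> exists r, is_comp p q r.
Proof.
move=> pq; have wP : qwalk Q (pstart p) (parrows p ++ parrows q).
  by rewrite walk_cat parrowsP -/(pend p) pq parrowsP.
by have [r rs ra] := qpath_of wP; exists r; rewrite /is_comp rs ra pq !eqxx.
Qed.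

Lemma pcoef_videm x p :
  pcoef (videm K x) p = ((pstart p == x) && (parrows p == [::]))%:R.
Proof. by rewrite /pcoef ffunE. Qed.

Lemma videm_delta x e : pstart e = x -> parrows e = [::] -> videm K x = pdelta e.
Proof.
move=> es ea; apply: pcoefP => q; rewrite pcoef_delta pcoef_videm.
congr (nat_of_bool _)%:R; apply/andP/eqP => [[/eqP qs /eqP qa]|->].
  by apply: qpath_inj; rewrite ?es ?ea.
by rewrite es ea !eqxx.
Qed.

Lemma videm_mull x f p :
  pcoef (videm K x * f) p = if pstart p == x then pcoef f p else 0.
Proof.
have [e es ea] := triv_path (Q := Q) x.
rewrite (videm_delta es ea) {1}[f]pdelta_sum mulr_sumr pcoef_sum.
have E q : pdelta e * (pcoef f q *: pdelta q)
     = if pstart q == x then pcoef f q *: pdelta q else 0.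
  rewrite -scalerAr; case: eqP => [qx|/eqP qx].
    by rewrite (@pdeltaM e q q) // /is_comp /pend es ea qx !eqxx.
  by rewrite pdeltaM0 ?scaler0 // /pend es ea eq_sym.
under eq_bigr do rewrite E.
rewrite (bigD1 p) //= big1 ?addr0 => [|q qp].
  by case: ifP; rewrite ?pcoef0 // pcoefZ pcoef_delta eqxx mulr1.
by case: ifP => _; rewrite ?pcoef0 // pcoefZ pcoef_delta eq_sym (negPf qp) mulr0.
Qed.

Lemma videm_mulr x f p :
  pcoef (f * videm K x) p = if pend p == x then pcoef f p else 0.
Proof.
have [e es ea] := triv_path (Q := Q) x.
rewrite (videm_delta es ea) {1}[f]pdelta_sum mulr_suml pcoef_sum.
have E q : (pcoef f q *: pdelta q) * pdelta e
     = if pend q == x then pcoef f q *: pdelta q else 0.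
  rewrite -scalerAl; case: eqP => [qx|/eqP qx].
    by rewrite (@pdeltaM q e q) // /is_comp es ea qx cats0 !eqxx.
  by rewrite pdeltaM0 ?scaler0 // es.
under eq_bigr do rewrite E.
rewrite (bigD1 p) //= big1 ?addr0 => [|q qp].
  by case: ifP; rewrite ?pcoef0 // pcoefZ pcoef_delta eqxx mulr1.
by case: ifP => _; rewrite ?pcoef0 // pcoefZ pcoef_delta eq_sym (negPf qp) mulr0.
Qed.

Lemma videm_sandwich x y f p : pcoef (videm K x * f * videm K y) p =
  if (pstart p == x) && (pend p == y) then pcoef f p else 0.
Proof. by rewrite videm_mulr videm_mull andbC; case: ifP. Qed.

Lemma supported_sandwich x y f :
  supported_from_to x y f <-> videm K x * f * videm K y = f.
Proof.
split=> [fP|<- p].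
  apply: pcoefP => p; rewrite videm_sandwich.
  by case: ifP => // nP; apply/esym/eqP; apply: contraFT nP => /fP[-> ->]; rewrite !eqxx.
by rewrite videm_sandwich; case: ifP => [/andP[/eqP -> /eqP ->]|]; rewrite ?eqxx.
Qed.

Lemma videmM x y : videm K x * videm K y = if x == y then videm K x else 0 :> KQ.
Proof.
apply: pcoefP => p; rewrite videm_mull.
case: (eqVneq x y) => [->|xy]; rewrite ?pcoef0 /pcoef !ffunE; case: eqP => //= ->.
by rewrite (negPf xy).
Qed.

Lemma videm_sum : \sum_x videm K x = 1 :> KQ.
Proof.
apply: pcoefP => p; rewrite pcoef_sum (bigD1 (pstart p)) //= big1 ?addr0 => [|x xp].
  by rewrite /pcoef !ffunE eqxx.
by rewrite /pcoef ffunE eq_sym (negPf xp).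
Qed.

Definition pspace x y : {vspace KQ} := (<[videm K x]> * fullv * <[videm K y]>)%VS.

Lemma pspaceP x y f : reflect (supported_from_to x y f) (f \in pspace x y).
Proof.
apply: (iffP (mem_sandwich _ _ _ _)) => [[b _ ->] p|/supported_sandwich fP].
  by rewrite videm_sandwich; case: ifP => [/andP[/eqP -> /eqP ->]|]; rewrite ?eqxx.
by exists f; rewrite ?memvf.
Qed.

Lemma videm_pspace x : videm K x \in pspace x x.
Proof. by apply/mem_sandwich; exists 1; rewrite ?memvf // mulr1 videmM eqxx. Qed.

Lemma pspaceM x y z f g : f \in pspace x y -> g \in pspace y z ->
  f * g \in pspace x z.
Proof.
case/mem_sandwich=> a _ -> /mem_sandwich[b _ ->]; apply/mem_sandwich.
by exists (a * videm K y * videm K y * b); rewrite ?memvf // !mulrA.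
Qed.

Lemma pspace_videml x y f : f \in pspace x y -> videm K x * f = f.
Proof. by case/mem_sandwich=> a _ ->; rewrite !mulrA videmM eqxx. Qed.

Lemma pspace_videmr x y f : f \in pspace x y -> f * videm K y = f.
Proof. by case/mem_sandwich=> a _ ->; rewrite -(mulrA (_ * a)) videmM eqxx. Qed.

Lemma mul_videm_sum f g : f * g = \sum_k (f * videm K k) * (videm K k * g).
Proof.
rewrite -[f in LHS]mulr1 -videm_sum mulr_sumr mulr_suml.
by apply: eq_bigr => k _; rewrite [RHS]mulrA -[in RHS](mulrA f) videmM eqxx.
Qed.

End PathBasis.

(** * Cartan entries and directedness *)

Section HomDimension.
Variables (K : fieldType) (T : triangular K).
Implicit Types (x y v : vert T).

(** By dim_module_hom these are the entries of the Cartan matrix: hdim x y is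
    dim Hom(P_y, P_x), the dimension of the span of the paths from x to y. *)
Definition hdim x y : nat := \dim (<[tidem x]> * fullv * <[tidem y]>)%VS.

Lemma tidemM x y : tidem x * tidem y = if x == y then tidem x else 0 :> talg T.
Proof. by rewrite /tidem -rmorphM videmM; case: ifP; rewrite ?rmorph0. Qed.

Lemma cartan_whole (i j : 'I_#|points (whole_algebra T)|) :
  cartan (whole_algebra T) i j = (hdim (enum_val j) (enum_val i))%:R.
Proof.
rewrite mxE /proj_module dim_module_hom ?memvf //= ?tidemM ?eqxx // => b c _ _.
exact: memvf.
Qed.

Lemma cartan_corner v (i j : 'I_#|points (corner_algebra v)|) :
  cartan (corner_algebra v) i j = (hdim (val (enum_val j)) (val (enum_val i)))%:R.
Proof.
rewrite mxE /proj_module /=; set B := (_ * _ * <[1 - tidem v]>)%VS.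
have el (x : vert T) : x != v -> (1 - tidem v) * tidem x = tidem x.
  by move=> xv; rewrite mulrBl mul1r tidemM eq_sym (negPf xv) subr0.
have er (x : vert T) : x != v -> tidem x * (1 - tidem v) = tidem x.
  by move=> xv; rewrite mulrBr mulr1 tidemM (negPf xv) subr0.
rewrite dim_module_hom; first last.
- move=> _ _ /mem_sandwich[b _ ->] /mem_sandwich[c _ ->]; apply/mem_sandwich.
  by exists (b * (1 - tidem v) * (1 - tidem v) * c); rewrite ?memvf // !mulrA.
- by rewrite tidemM eqxx.
- apply/mem_sandwich; exists (tidem (val (enum_val i))); rewrite ?memvf //.
  by rewrite el ?er //; apply: (valP (enum_val i)).
congr (_%:R); rewrite /hdim /B.
rewrite prodvA prodvA prodv_line er -?prodvA ?prodv_line ?el //.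
  exact: (valP (enum_val i)).
exact: (valP (enum_val j)).
Qed.

Lemma hdimE x y :
  hdim x y = \dim (linfun (qproj (tproper_bideal T)) @: pspace K x y)%VS.
Proof.
congr (\dim _); apply/eqP; rewrite eqEsubv; apply/andP; split; apply/subvP => u.
  case/mem_sandwich=> b _ ->; apply/memv_imgP.
  exists (videm K x * vsval b * videm K y).
    by apply/mem_sandwich; exists (vsval b); rewrite ?memvf.
  by rewrite lfunE /= !rmorphM /= Defs.vsvalK.
case/memv_imgP=> _ /mem_sandwich[b _ ->] ->; apply/mem_sandwich.
by exists (qproj _ b); rewrite ?memvf // lfunE /= !rmorphM.
Qed.

Lemma dim_pspace_cap x y :
  (hdim x y + \dim (pspace K x y :&: tideal T) = \dim (pspace K x y))%N.
Proof.
rewrite hdimE addnC -[RHS](limg_ker_dim (linfun (qproj (tproper_bideal T)))).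
congr (\dim _ + _)%N; apply/vspaceP => f; rewrite !memv_cap memv_ker lfunE /=.
by rewrite qproj_eq0.
Qed.

Definition reach (x y : vert T) : bool :=
  [exists p : qpath T, (pstart p == x) && (pend p == y)].

Lemma hdim_eq0 x y : ~~ reach x y -> hdim x y = 0%N.
Proof.
move=> nxy; suff P0 : pspace K x y = 0%VS.
  move: (dim_pspace_cap x y); rewrite P0 dimv0 => /eqP.
  by rewrite addn_eq0 => /andP[/eqP].
apply/eqP; rewrite -subv0; apply/subvP => f /pspaceP fP; rewrite memv0.
apply/eqP/pcoefP => p; rewrite pcoef0; apply/eqP; apply: contraNT nxy => /fP[sp ep].
by apply/existsP; exists p; rewrite sp ep !eqxx.
Qed.

Lemma closed_path (p : qpath T) : pend p = pstart p -> parrows p = [::].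
Proof. by move/(quiver_acyclic (parrowsP p)). Qed.

(** Without oriented cycles, the trivial path is the only path from v to v. *)
Lemma loop_coef v (f : path_alg K T) : f \in pspace K v v ->
  exists a, f = a *: videm K v.
Proof.
move/pspaceP=> fP; have [e es ea] := triv_path (Q := T) v.
have uniq_e p : pstart p = v -> pend p = v -> p = e.
  move=> sp ep; apply: qpath_inj; rewrite ?sp ?es // ea closed_path //.
  by rewrite sp ep.
exists (pcoef f e); apply: pcoefP => p; rewrite pcoefZ pcoef_videm.
case: (eqVneq p e) => [->|pe]; first by rewrite es ea !eqxx mulr1.
case: andP => [[/eqP sp /eqP ap]|_].
  by case/eqP: pe; apply: qpath_inj; rewrite ?sp ?ap.
rewrite mulr0; apply/eqP; apply: contraNT pe => /fP[sp ep]; apply/eqP.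
exact: uniq_e.
Qed.

Lemma videm_notin v : videm K v \notin tideal T.
Proof.
have [e es ea] := triv_path (Q := T) v.
apply/negP => /tideal_long /(_ e); rewrite pcoef_videm es ea !eqxx oner_eq0.
by move/(_ isT).
Qed.

Lemma hdim_diag v : hdim v v = 1%N.
Proof.
have := dim_pspace_cap v v; have -> : pspace K v v = <[videm K v]>%VS.
  apply/eqP; rewrite eqEsubv; apply/andP; split; apply/subvP => f.
    by case/loop_coef=> a ->; rewrite rpredZ // memv_line.
  by case/vlineP=> a ->; rewrite rpredZ // videm_pspace.
rewrite dim_vline; have -> : (<[videm K v]> :&: tideal T = 0)%VS.
  apply/eqP; rewrite -subv0; apply/subvP => f; rewrite memv_cap memv0.
  case/andP=> /vlineP[a ->] aI; case: (eqVneq a 0) => [->|a0]; first by rewrite scale0r.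
  case/negP: (videm_notin v); rewrite -[videm K v](scalerK a0) rpredZ //.
rewrite dimv0 addn0 => ->; case: eqP => // v0.
by case/negP: (videm_notin v); rewrite v0 mem0v.
Qed.

Definition reach_rank (x : vert T) : nat := #|[set y | reach y x]|.

(** Every vertex that reaches x also reaches y, whereas y itself does not reach x,
    as the quiver has no oriented cycle. *)
Lemma reach_rank_lt x y : x != y -> reach x y -> (reach_rank x < reach_rank y)%N.
Proof.
move=> xy /existsP[p /andP[/eqP sp /eqP ep]]; apply: proper_card.
apply/properP; split.
  apply/subsetP => z; rewrite !inE => /existsP[q /andP[/eqP sq /eqP eq_]].
  have [r cr] := comp_ex (etrans eq_ (esym sp)); apply/existsP; exists r.
  by rewrite (is_comp_end cr) ep; case/and3P: cr => /eqP -> _ _; rewrite sq !eqxx.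
exists y; rewrite !inE.
  by have [e es ea] := triv_path y; apply/existsP; exists e; rewrite /pend es ea !eqxx.
apply/negP => /existsP[q /andP[/eqP sq /eqP eq_]].
have [r cr] := comp_ex (etrans eq_ (esym sp)).
have : parrows r = [::].
  apply: closed_path; rewrite (is_comp_end cr) ep.
  by case/and3P: cr => /eqP -> _ _; rewrite sq.
case/and3P: cr => _ _ /eqP -> /(congr1 size); rewrite size_cat => /eqP.
rewrite addn_eq0 => /andP[_ /nilP p0].
by case/eqP: xy; rewrite -sp -ep /pend p0.
Qed.

Lemma hdim_rank x y : x != y -> hdim x y != 0%N -> (reach_rank x < reach_rank y)%N.
Proof.
move=> xy h0; apply: reach_rank_lt => //; apply: contraNT h0 => nxy.
by rewrite hdim_eq0.
Qed.

End HomDimension.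

(** Both sides are the dimension of the image of pspace x y under maps with the same
    kernel: the projection modulo the ideal, and phi followed by the projection. *)
Lemma hdim_transfer (K : fieldType) (T T' : triangular K)
    (phi : 'Hom(path_alg K T, path_alg K T')) x y x' y' :
  (phi @: pspace K x y = pspace K x' y')%VS ->
  (forall g, g \in pspace K x y -> (phi g \in tideal T') = (g \in tideal T)) ->
  hdim x y = hdim x' y'.
Proof.
move=> im ker; rewrite !hdimE -im -limg_comp.
set f := linfun _; set g := (_ \o phi)%VF.
have kfg : (pspace K x y :&: lker g = pspace K x y :&: lker f)%VS.
  apply/vspaceP => u; rewrite !memv_cap; case: (boolP (u \in _)) => //= uP.
  by rewrite !memv_ker !lfunE /= lfunE /= !qproj_eq0 ker.
apply: (@addnI (\dim (pspace K x y :&: lker f))).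
by rewrite limg_ker_dim -kfg limg_ker_dim.
Qed.

(** * Chains *)

Section Chain.
Variables (d : Order.disp_t) (S : finOrderType d) (S0 : (0 < #|S|)%N).
Local Notation QS := (hasse S0).
Implicit Types (s : S) (q : seq (arr QS)).
Local Open Scope order_scope.

Lemma covers_uniq (s a b : S) : covers s a -> covers s b -> a = b.
Proof.
case/andP=> sa /forallP na /andP[sb /forallP nb].
case: (ltgtP a b) => // [ab|ba].
  by have := nb a; rewrite sa ab.
by have := na b; rewrite sb ba.
Qed.

Lemma harr_uniq (a b : arr QS) : hd a = hd b -> a = b.
Proof.
case: a b => [[x y] ca] [[x' z] cb]; rewrite /= /hhd /= => E; subst x'.
by apply: val_inj; congr (_, _); apply: (covers_uniq ca cb).
Qed.

(** In a chain each element has at most one cover, which forces every step. *)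
Lemma hasse_walk_uniq s q q' : qwalk QS s q -> qwalk QS s q' ->
  qend QS s q = qend QS s q' -> q = q'.
Proof.
elim: q s q' => [|a q IH] s [|b q'] // P P' E.
- exact: esym (quiver_acyclic P' (esym E)).
- exact: quiver_acyclic P E.
case/andP: P => /eqP ha P; case/andP: P' => /eqP hb P'.
have ab : a = b by apply: harr_uniq; rewrite ha hb.
by subst b; congr (_ :: _); apply: IH E.
Qed.

Lemma hasse_walk_ex s s' : s <= s' -> exists q, qwalk QS s q /\ qend QS s q = s'.
Proof.
have [n] := ubnP #|[set z | (s < z) && (z <= s')]|.
elim: n s => // n IH s sn; rewrite le_eqVlt => /predU1P[->|ss']; first by exists [::].
case: (@arg_minP _ _ _ s' (fun z => s < z) id ss') => m sm mmin.
have ms' : m <= s' by apply: mmin.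
(* m is the least element above s. *)
have cm : covers s m.
  rewrite /covers sm; apply/forallP => z; apply/negP => /andP[/mmin mz zm].
  by move: (le_lt_trans mz zm); rewrite ltxx.
have [||q [qP qE]] := IH m => //.
  rewrite -ltnS; apply: leq_trans sn; rewrite ltnS; apply: proper_card.
  apply/properP; split.
    by apply/subsetP => z; rewrite !inE => /andP[mz ->]; rewrite (lt_trans sm mz).
  by exists m; rewrite !inE ?sm ?ms' // ltxx.
exists ((exist _ (s, m) cm : arr QS) :: q); split=> //.
by apply/andP; split.
Qed.

Lemma smin_le s s' : s \in smin S -> s <= s'.
Proof. by rewrite inE => /forallP/(_ s'); rewrite -leNgt. Qed.

Lemma le_smax s s' : s \in smax S -> s' <= s.
Proof. by rewrite inE => /forallP/(_ s'); rewrite -leNgt. Qed.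

Lemma smin_uniq s s' : s \in smin S -> s' \in smin S -> s = s'.
Proof. by move=> ms ms'; apply/le_anti; rewrite !smin_le. Qed.

Lemma smax_uniq s s' : s \in smax S -> s' \in smax S -> s = s'.
Proof. by move=> ms ms'; apply/le_anti; rewrite !le_smax. Qed.

Lemma smin_ex : exists s, s \in smin S.
Proof.
have /card_gt0P[s _] := S0.
case: (@arg_minP _ _ _ s (fun=> true) id isT) => m _ mmin; exists m.
by rewrite inE; apply/forallP => z; rewrite -leNgt mmin.
Qed.

Lemma smax_ex : exists s, s \in smax S.
Proof.
have /card_gt0P[s _] := S0.
case: (@arg_maxP _ _ _ s (fun=> true) id isT) => m _ mmax; exists m.
by rewrite inE; apply/forallP => z; rewrite -leNgt; apply: mmax.
Qed.

End Chain.

(** * Linear extensions of maps of paths *)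

Section PathPush.
Variables (K : fieldType) (Q Q' : quiver) (c : qpath Q' -> qpath Q).
Notation KQ := (path_alg K Q).
Notation KQ' := (path_alg K Q').
Implicit Types (r : qpath Q') (p : qpath Q) (g h : KQ').

Definition path_push_fun g : KQ := \sum_r pcoef g r *: pdelta K (c r).

Fact path_push_linear : linear path_push_fun.
Proof.
move=> a f g; rewrite /path_push_fun scaler_sumr -big_split /=.
by apply: eq_bigr => r _; rewrite pcoefD pcoefZ scalerDl scalerA.
Qed.
HB.instance Definition _ :=
  GRing.isLinear.Build K KQ' KQ _ path_push_fun path_push_linear.

Definition path_push : 'Hom(KQ', KQ) := linfun path_push_fun.

Lemma path_pushE g : path_push g = \sum_r pcoef g r *: pdelta K (c r).
Proof. by rewrite lfunE. Qed.

Lemma path_push_coef g p : pcoef (path_push g) p = \sum_(r | c r == p) pcoef g r.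
Proof.
rewrite path_pushE pcoef_sum [RHS]big_mkcond; apply: eq_bigr => r _.
by rewrite pcoefZ pcoef_delta eq_sym; case: ifP => _; rewrite ?mulr1 ?mulr0.
Qed.

Lemma path_push_delta r : path_push (pdelta K r) = pdelta K (c r).
Proof.
rewrite path_pushE (bigD1 r) //= pcoef_delta eqxx scale1r big1 ?addr0 // => q qr.
by rewrite pcoef_delta (negPf qr) scale0r.
Qed.

Lemma path_push_supp g p : pcoef (path_push g) p != 0 ->
  exists2 r, pcoef g r != 0 & c r = p.
Proof.
move=> nz; case: (pickP (fun r => (pcoef g r != 0) && (c r == p))) => [r|no].
  by case/andP=> ? /eqP ?; exists r.
case/eqP: nz; rewrite path_push_coef; apply: big1 => r cr.
by apply/eqP; have := no r; rewrite cr andbT => /negbFE.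
Qed.

(** A map of paths that glues vertices can turn non-composable pairs into
    composable ones, so it only respects products of elements which meet in
    a single vertex. *)
Lemma path_pushM x y z g h :
  (forall r1 r2 r, is_comp r1 r2 r -> is_comp (c r1) (c r2) (c r)) ->
  g \in pspace K x y -> h \in pspace K y z ->
  path_push (g * h) = path_push g * path_push h.
Proof.
move=> cP /pspaceP gP /pspaceP hP.
rewrite {1}[g]pdelta_sum {1}[h]pdelta_sum (path_pushE g) (path_pushE h) !mulr_suml.
rewrite linear_sum; apply: eq_bigr => r1 _ /=.
rewrite !mulr_sumr linear_sum; apply: eq_bigr => r2 _ /=.
rewrite -!scalerAl -!scalerAr !linearZ /= [RHS]scalerA mulrC -[RHS]scalerA.
case: (eqVneq (pcoef g r1) 0) => [->|/gP[_ e1]]; first by rewrite !scale0r.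
case: (eqVneq (pcoef h r2) 0) => [->|/hP[s2 _]]; first by rewrite !scale0r !scaler0.
have [r rc] := comp_ex (etrans e1 (esym s2)).
by rewrite (pdeltaM K rc) path_push_delta (pdeltaM K (cP _ _ _ rc)).
Qed.

Lemma path_push_inj x y g :
  (forall r r', pstart r = x -> pstart r' = x -> pend r = y -> pend r' = y ->
    c r = c r' -> r = r') ->
  g \in pspace K x y -> path_push g = 0 -> g = 0.
Proof.
move=> ci /pspaceP gP g0; apply: pcoefP => r; rewrite pcoef0.
apply/eqP; apply/contraT => gr; have [sr er] := gP _ gr.
have E : pcoef (path_push g) (c r) = pcoef g r.
  rewrite path_push_coef (bigD1 r) //= big1 ?addr0 // => r' /andP[/eqP cr rr'].
  apply/eqP; apply: contraNT rr' => /gP[sr' er']; apply/eqP.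
  exact: ci.
by move: gr; rewrite -E g0 pcoef0 eqxx.
Qed.

Lemma path_push_comb (f : KQ) (u : qpath Q -> KQ') :
  (forall p, pcoef f p != 0 -> path_push (u p) = pdelta K p) ->
  path_push (\sum_p pcoef f p *: u p) = f.
Proof.
move=> uP; rewrite [RHS]pdelta_sum linear_sum; apply: eq_bigr => p _ /=.
rewrite linearZ /=; case: (eqVneq (pcoef f p) 0) => [->|/uP -> //].
by rewrite !scale0r.
Qed.

(** Although path_push is not an algebra morphism, the g whose components
    videm x * g * videm y are all sent to J form an ideal: such a component of a
    product is a sum over the middle vertex of products that path_push respects. *)
Lemma path_push_ideal (J : {vspace KQ}) (X : KQ' -> Prop) :
  (forall r1 r2 r, is_comp r1 r2 r -> is_comp (c r1) (c r2) (c r)) ->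
  is_ideal J ->
  (forall h, X h -> exists i j, supported_from_to i j h) ->
  (forall h, X h -> path_push h \in J) ->
  forall x y g, g \in ideal_gen X -> path_push (videm K x * g * videm K y) \in J.
Proof.
move=> cP idJ Xs XJ x y g.
pose Z h := forall i j, path_push (videm K i * h * videm K j) \in J.
have Z0 : Z 0 by move=> i j; rewrite mulr0 mul0r linear0 mem0v.
have ZD a h h' : Z h -> Z h' -> Z (a *: h + h').
  move=> Zh Zh' i j; rewrite mulrDr mulrDl -scalerAr -scalerAl linearP /=.
  by rewrite rpredD // rpredZ.
suff sub : (ideal_gen X <= vspan Z)%VS.
  by move/(subvP sub)/(vspanP _ Z0 ZD).
have pushM i j a h : path_push (videm K i * (a * h) * videm K j) =
    \sum_k path_push (videm K i * a * videm K k) * path_push (videm K k * h * videm K j).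
  have -> : videm K i * (a * h) * videm K j =
      \sum_k (videm K i * a * videm K k) * (videm K k * h * videm K j).
    by rewrite mulrA -mulrA mul_videm_sum; apply: eq_bigr => k _; rewrite !mulrA.
  rewrite linear_sum; apply: eq_bigr => k _ /=.
  by apply: (path_pushM cP (x := i) (y := k) (z := j)); apply/mem_sandwich;
    [exists a | exists h]; rewrite ?memvf.
apply: ideal_gen_sub => [a h /(vspanP _ Z0 ZD) Zh|h Xh].
  split; apply/(vspanP _ Z0 ZD) => i j; rewrite pushM rpred_sum // => k _.
    by have [Ja _] := idJ (path_push (videm K i * a * videm K k)) _ (Zh k j).
  by have [_ Ja] := idJ (path_push (videm K k * a * videm K j)) _ (Zh i k).
apply/mem_vspan => i j; have [i0 [j0 hP]] := Xs h Xh.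
have -> : videm K i * h * videm K j = if (i0 == i) && (j0 == j) then h else 0.
  apply: pcoefP => r; rewrite videm_sandwich.
  rewrite (fun_if (fun f => pcoef f r)) pcoef0.
  case: (eqVneq (pcoef h r) 0) => [->|/hP[<- <-] //]; by do 2!case: ifP.
by case: ifP => _; rewrite ?linear0 ?mem0v ?XJ.
Qed.

End PathPush.

(** * Words of the inserted quiver and their collapse *)

Section Words.
Variables (K : fieldType) (T : triangular K) (v : vert T).
Variables (d : Order.disp_t) (S : finPOrderType d) (S0 : (0 < #|S|)%N).
Local Notation QS := (hasse S0).
Local Notation Q' := (@ins_quiver K T v d S S0).
Local Notation rvert := (raw_vert T S).
Local Notation rarr := (raw_arr T S0).
Local Notation varr := (@valid_arr K T v d S S0).
Local Notation rhd := (@raw_hd K T d S S0).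
Local Notation rtl := (@raw_tl K T d S S0).
Local Notation carr := (@collapse_arr K T d S S0).
Local Notation nw := (@new K T d S S0).
Local Notation od := (@old K T d S S0).
Implicit Types (x y : rvert) (w : seq rarr) (r : qpath Q') (p : qpath T).

(** The paths of the inserted quiver, seen through their words of raw arrows:
    the relations of the insertion are written with such words. *)
Definition raw_walk x w : bool :=
  [&& valid_vert v x, all varr w & walk rhd rtl x w].

Lemma raw_walk_cons x a w : raw_walk x (a :: w) =
  [&& valid_vert v x, valid_arr v a, raw_hd a == x & raw_walk (raw_tl a) w].
Proof.
rewrite /raw_walk /=; case va: (valid_arr v a); rewrite ?andbF //=.
have -> : valid_vert v (raw_tl a) by apply: (valid_tl (exist _ a va : ins_arr v S0)).
by case: (valid_vert v x); case: (_ == x); case: (all _ _).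
Qed.

Lemma raw_walk_cat x w w' : raw_walk x w -> raw_walk (raw_end x w) w' ->
  raw_walk x (w ++ w').
Proof.
elim: w x => //= a w IH x; rewrite !raw_walk_cons => /and4P[-> -> -> wP] w'P /=.
exact: IH.
Qed.

Lemma raw_path x w : raw_walk x w ->
  exists2 r : qpath Q', val (pstart r) = x & map val (parrows r) = w.
Proof.
case/and3P=> vx aw wP.
have [w' w'E] : exists w' : seq (arr Q'), map val w' = w.
  elim: w aw {wP} => [|a w IH] /=; first by exists [::].
  by case/andP=> va /IH[w' <-]; exists ((exist _ a va : ins_arr v S0) :: w').
have w'P : qwalk Q' (exist _ x vx : ins_vert v S) w'.
  move: vx wP; rewrite -w'E {aw w'E}; elim: w' x => //= a w' IH x vx /andP[/eqP hx wP].
  by rewrite (IH _ (valid_tl a)) // andbT; apply/eqP/val_inj.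
by have [r rs ra] := qpath_of w'P; exists r; rewrite ?rs ?ra.
Qed.

Lemma collapse_path_subproof r : qwalk T (collapse_vert v (val (pstart r)))
  (pmap carr (map val (parrows r))).
Proof. by have [] := collapse_walk (parrowsP r). Qed.

Definition collapse_path r : qpath T := s2val (qpath_of (collapse_path_subproof r)).

Lemma collapse_start r : pstart (collapse_path r) = collapse_vert v (val (pstart r)).
Proof. by rewrite /collapse_path; case: qpath_of. Qed.

Lemma collapse_arrows r : parrows (collapse_path r) =
  pmap carr (map val (parrows r)).
Proof. by rewrite /collapse_path; case: qpath_of. Qed.

Lemma collapse_end r : pend (collapse_path r) = collapse_vert v (val (pend r)).
Proof.
rewrite /pend collapse_start collapse_arrows.
by have [] := collapse_walk (parrowsP r).
Qed.

Lemma collapse_comp r1 r2 r : is_comp r1 r2 r ->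
  is_comp (collapse_path r1) (collapse_path r2) (collapse_path r).
Proof.
case/and3P=> /eqP rs /eqP re /eqP ra; apply/and3P; split; apply/eqP.
- by rewrite !collapse_start rs.
- by rewrite collapse_end collapse_start re.
by rewrite !collapse_arrows ra map_cat pmap_cat.
Qed.

Local Notation KQ := (path_alg K T).
Local Notation KQ' := (path_alg K Q').

(** The linear map that contracts the inserted poset to v. *)
Definition collapse : 'Hom(KQ', KQ) := path_push K collapse_path.

Lemma collapseM (x y z : vert Q') (g h : KQ') :
  g \in pspace K x y -> h \in pspace K y z ->
  collapse (g * h) = collapse g * collapse h.
Proof. exact: path_pushM collapse_comp. Qed.

Lemma collapse_comb (f : KQ) (u : qpath T -> KQ') :
  (forall p, pcoef f p != 0 -> collapse (u p) = pdelta K p) ->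
  collapse (\sum_p pcoef f p *: u p) = f.
Proof. exact: path_push_comb. Qed.

Lemma pathwE r x w : val (pstart r) = x -> map val (parrows r) = w ->
  pathw v x w = pdelta K r.
Proof.
move=> <- <-; apply: pcoefP => q; rewrite pcoef_delta /pcoef ffunE.
congr (nat_of_bool _)%:R; apply/andP/eqP => [[/eqP qs /eqP qa]|->//].
apply: qpath_inj; first exact: val_inj.
exact: (inj_map val_inj).
Qed.

Lemma collapse_pathw x w p : raw_walk x w -> collapse_vert v x = pstart p ->
  pmap carr w = parrows p -> collapse (pathw v x w) = pdelta K p.
Proof.
move=> /raw_path[r rs ra] xp wp; rewrite (pathwE rs ra) path_push_delta.
by congr pdelta; apply: qpath_inj; rewrite ?collapse_start ?collapse_arrows ?rs ?ra.
Qed.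

Lemma pathw_pspace (x y : vert Q') w : raw_end (val x) w = val y ->
  pathw v (val x) w \in pspace K x y.
Proof.
move=> E; apply/pspaceP => r /pathw_neq0[rs ra].
by split; apply: val_inj; rewrite ?raw_endP // rs ra.
Qed.

Lemma raw_walk_old (i : vert T) (w : seq (arr T)) : v \notin i :: map (@tl T) w ->
  qwalk T i w -> raw_walk (old_vert S i) (map od w).
Proof.
elim: w i => [|a w IH] i; rewrite in_cons negb_or => /andP[vi vw].
  by rewrite /raw_walk /= eq_sym vi.
case/andP=> /eqP hi wP; rewrite raw_walk_cons (IH (tl a)) //=.
rewrite hi eq_sym vi eqxx !andbT /=.
by move: vw; rewrite in_cons negb_or eq_sym => /andP[].
Qed.

Lemma pmap_old (w : seq (arr T)) : pmap carr (map od w) = w.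
Proof. by elim: w => //= a w ->. Qed.

Lemma raw_walk_new s q : qwalk QS s q -> raw_walk (new_vert T s) (map nw q).
Proof.
elim: q s => // a q IH s /andP[/eqP hs wP]; rewrite raw_walk_cons (IH (tl a)) //=.
by rewrite -hs eqxx.
Qed.

Lemma pmap_new q : pmap carr (map nw q) = [::].
Proof. by elim: q. Qed.

(** This is what keeps the arrows before the last one of a walk to v away from v,
    so that they survive in the inserted quiver. *)
Lemma walk_to_neq (i : vert T) (w : seq (arr T)) : qwalk T i w -> w != [::] ->
  qend T i w = v -> i != v.
Proof.
move=> wP w0 wv; apply: contraNneq w0 => iv.
by rewrite (quiver_acyclic wP) // wv iv.
Qed.

Lemma raw_walk_set_last (i : vert T) (w : seq (arr T)) s : s \in smin S ->
  qwalk T i w -> w != [::] -> qend T i w = v ->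
  raw_walk (old_vert S i) (set_last S0 w s).
Proof.
move=> sm; elim: w i => // a w IH i wP _ wv.
have iv := walk_to_neq wP isT wv; case/andP: wP => /eqP hi wP.
case: w IH wP wv => [|b w] IH wP wv.
  by rewrite raw_walk_cons /= iv sm hi eqxx /raw_walk /= -wv eqxx.
rewrite [set_last _ _ _]/= raw_walk_cons (IH (tl a)) //= hi iv eqxx andbT /=.
by rewrite andbT; exact: (@walk_to_neq (tl a) (b :: w) wP isT wv).
Qed.

Lemma pmap_set_last (w : seq (arr T)) (s : S) : pmap carr (set_last S0 w s) = w.
Proof. by elim: w => // a [|b w] //= ->. Qed.

Lemma raw_walk_set_first s (w : seq (arr T)) : s \in smax S ->
  qwalk T v w -> raw_walk (new_vert T s) (set_first S0 s w).
Proof.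
move=> sm; case: w => // b w wP; rewrite [set_first _ _ _]/= raw_walk_cons.
have vN := acyclic_uniq (@quiver_acyclic T) wP.
case/andP: wP => /eqP hv wP; rewrite (raw_walk_old _ wP) /= ?hv ?sm ?eqxx //.
by case/andP: vN.
Qed.

Lemma pmap_set_first (s : S) (w : seq (arr T)) : pmap carr (set_first S0 s w) = w.
Proof. by case: w => //= b w; rewrite pmap_old. Qed.

End Words.

(** * Insertion of a chain *)

Section ChainInsertion.
Variables (K : fieldType) (T : triangular K) (v : vert T).
Variables (d : Order.disp_t) (S : finOrderType d) (S0 : (0 < #|S|)%N).
Local Notation QS := (hasse S0).
Local Notation T' := (@insertion K T v d S S0).
Local Notation Q' := (@ins_quiver K T v d S S0).
Local Notation rvert := (raw_vert T S).
Local Notation carr := (@collapse_arr K T d S S0).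
Local Notation nw := (@new K T d S S0).
Local Notation od := (@old K T d S S0).
Local Notation KQ := (path_alg K T).
Local Notation KQ' := (path_alg K Q').
Local Notation clps := (collapse v S0).

(** At each vertex the collapsed word tells how to go on: an arrow of the original
    quiver has a single lift, because a chain has one minimal and one maximal
    element, and inside the chain the next step is the unique cover, which exists
    exactly when the maximal element has not been reached. *)
Lemma collapse_word_inj (x : vert Q') (w w' : seq (arr Q')) :
  qwalk Q' x w -> qwalk Q' x w' -> qend Q' x w = qend Q' x w' ->
  pmap carr (map val w) = pmap carr (map val w') -> w = w'.
Proof.
elim: w x w' => [|a w IH] x [|b w'] // P P' E M.
- exact: esym (quiver_acyclic P' (esym E)).
- exact: quiver_acyclic P E.
case/andP: P => /eqP ha P; case/andP: P' => /eqP hb P'.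
suff ab : val a = val b.
  have {}ab : a = b by apply: val_inj.
  subst b; congr (_ :: _); apply: IH E _ => //.
  by move: M => /=; case: (carr (val a)) => //= c [].
have {ha} hab : raw_hd (val a) = raw_hd (val b) by move: ha; rewrite -hb => /(congr1 val).
have va := valP a; have vb := valP b; move: hab va vb M {hb P P' E} => /=.
case: (val a) => [[[a0|a0]|[a0 s]]|[s a0]];
  case: (val b) => [[[b0|b0]|[b0 s']]|[s' b0]] //=.
- by move=> _ _ _ [->].
- by move=> _ /andP[_ /eqP n1] /andP[/eqP n2 _] [e]; rewrite e in n1.
- by case=> e _ _ _; rewrite (harr_uniq e).
- case=> e _ /andP[_ sm] _.
  have := harr_lt a0; rewrite [hhd _]e => /lt_le_trans /(_ (le_smax _ sm)).
  by rewrite ltxx.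
- by move=> _ /andP[/eqP n1 _] /andP[_ /eqP n2] [e]; rewrite -e in n2.
- by move=> _ /andP[_ m1] /andP[_ m2] [->]; rewrite (smin_uniq m1 m2).
- case=> e /andP[_ sm] _ _.
  have := harr_lt b0; rewrite -[hhd _]e => /lt_le_trans /(_ (le_smax _ sm)).
  by rewrite ltxx.
- by move=> [->] _ _ [->].
Qed.

Lemma collapse_path_inj (r r' : qpath Q') : pstart r = pstart r' -> pend r = pend r' ->
  collapse_path r = collapse_path r' -> r = r'.
Proof.
move=> es ee ec; apply: qpath_inj => //; apply: (@collapse_word_inj (pstart r)).
- exact: parrowsP.
- by rewrite es; apply: parrowsP.
- by rewrite {2}es.
by rewrite -!collapse_arrows ec.
Qed.

Lemma collapse_inj (x y : vert Q') (g : KQ') : g \in pspace K x y -> clps g = 0 -> g = 0.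
Proof.
apply: path_push_inj => r r' rx r'x ry r'y.
by apply: collapse_path_inj; rewrite ?rx ?ry.
Qed.

(** All choices of p tilde collapse back to p. *)
Lemma tilde_word p (u : KQ') : is_tilde p u -> pstart p != v -> pend p != v ->
  exists w, [/\ u = pathw v (old_vert S (pstart p)) w,
    raw_walk v (old_vert S (pstart p)) w, pmap carr w = parrows p &
    raw_end (old_vert S (pstart p)) w = old_vert S (pend p)].
Proof.
case=> [[vN ->] _ _|[w1 [w2 [s [q [aE e1 [qP sm qm ->]]]]]] vs ve].
  exists (map od (parrows p)); split=> //.
  - exact: raw_walk_old vN (parrowsP p).
  - by rewrite pmap_old.
  - by rewrite raw_end_old.
have w10 : w1 != [::].
  by apply: contraNneq vs => w10; rewrite -e1 w10.
have w20 : w2 != [::].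
  by apply: contraNneq ve => w20; rewrite /pend aE w20 cats0 e1.
have := parrowsP p; rewrite aE walk_cat e1 => /andP[P1 P2].
eexists; split; first by [].
- apply: raw_walk_cat; first exact: raw_walk_set_last.
  rewrite raw_end_set_last //; apply: raw_walk_cat; first exact: raw_walk_new.
  by rewrite raw_end_new; apply: raw_walk_set_first.
- by rewrite !pmap_cat pmap_set_last pmap_new pmap_set_first.
rewrite !raw_end_cat (raw_end_set_first _ _ v) //.
by rewrite /pend aE wend_cat e1.
Qed.

Lemma tilde_ex (p : qpath T) : pstart p != v -> exists u : KQ', is_tilde p u.
Proof.
move=> vs; case: (boolP (v \in map (@tl T) (parrows p))) => [vp|vN]; last first.
  eexists; left; split; last by [].
  by rewrite in_cons negb_or eq_sym vs.
have [w1 [w2 [aE e1]]] : exists w1 w2, parrows p = w1 ++ w2 /\ qend T (pstart p) w1 = v.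
  case/mapP: vp => a ap ->; case/splitPr: ap => s1 s2; exists (rcons s1 a), s2.
  by rewrite cat_rcons; split=> //; rewrite /wend map_rcons last_rcons.
have [s0 m0] := smin_ex S0; have [s1 m1] := smax_ex S0.
have [q [qP qE]] := hasse_walk_ex S0 (smin_le s1 m0).
eexists; right; exists w1, w2, s0, q; split=> //; split=> //.
by rewrite qE.
Qed.

(** The relations ins_rel_2a to ins_rel_2d are trivial for a chain, where parallel
    walks coincide; the others collapse to the relation f they come from. *)
Lemma collapse_rel (g : KQ') : ins_rel g -> clps g \in tideal T.
Proof.
case=> {g}.
- move=> f i s fI fs sm; rewrite collapse_comb // => p nz.
  have p0 := long_neq0 (tideal_long fI nz); have [_ ep] := fs _ nz.
  apply: collapse_pathw => //; last exact: pmap_set_last.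
  exact: raw_walk_set_last (parrowsP p) p0 ep.
- move=> f j s fI fs sm; rewrite collapse_comb // => p nz.
  have [sp _] := fs _ nz; have pP := parrowsP p; rewrite sp in pP.
  apply: collapse_pathw; [exact: raw_walk_set_first | by [] | exact: pmap_set_first].
- move=> s q1 q2 P1 P2 E; rewrite (hasse_walk_uniq P1 P2 E) subrr linear0.
  exact: mem0v.
- move=> a s1 q1 s2 q2 ta P1 P2 m1 m2 E; have ss := smin_uniq m1 m2; subst s2.
  by rewrite (hasse_walk_uniq P1 P2 E) subrr linear0 mem0v.
- move=> b s q1 q2 hb P1 P2 m1 m2; have E := smax_uniq m1 m2.
  by rewrite (hasse_walk_uniq P1 P2 E) subrr linear0 mem0v.
- move=> a b s1 q1 s2 q2 ta hb P1 P2 m1 m2 M1 M2.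
  have ss := smin_uniq m1 m2; subst s2; have E := smax_uniq M1 M2.
  by rewrite (hasse_walk_uniq P1 P2 E) subrr linear0 mem0v.
move=> f i j tilde fI fs iv jv tP; rewrite collapse_comb // => p nz.
have [si ej] := fs _ nz; have [||w [-> wP wa _]] := tilde_word (tP _ nz).
- by rewrite si.
- by rewrite ej.
exact: collapse_pathw wP _ wa.
Qed.

Lemma collapse_ideal (x y : vert Q') (g : KQ') : g \in ins_ideal v S0 ->
  clps (videm K x * g * videm K y) \in tideal T.
Proof.
apply: path_push_ideal => [r1 r2 r||h|h].
- exact: collapse_comp.
- exact: tideal_is_ideal.
- by case/ins_rel_is_relation.
- exact: collapse_rel.
Qed.

(** Paths from s to s' in S exist only for s <= s'; for all other endpoints the
    paths are those of the original quiver. *)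
Definition ins_reach (x y : rvert) : bool :=
  if x is inr s then if y is inr s' then (s <= s')%O else true else true.

(** Paths lift, and relations lift to relations. If x and y are outside the chain,
    the lift is of the form ins_rel_3. If only x is, then it is of the form
    ins_rel_1a, followed by the walk inside the chain from its minimum to y; dually,
    if only y is, a walk from x to the maximum precedes an element of the form
    ins_rel_1b. Between two elements of the chain, f is a multiple of the trivial
    path at v, which is in the ideal only if it is 0. *)
Lemma lift_ex (x y : vert Q') (f : KQ) :
  f \in pspace K (collapse_vert v (val x)) (collapse_vert v (val y)) ->
  ins_reach (val x) (val y) ->
  exists g, [/\ g \in pspace K x y, clps g = f & f \in tideal T -> g \in ins_ideal v S0].
Proof.
have idI : is_ideal (ins_ideal v S0) by apply: ideal_gen_is_ideal.
pose nv (s : S) : vert Q' := exist _ (new_vert T s) isT.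
have chainP s s' : (s <= s')%O -> exists2 C : KQ',
    C \in pspace K (nv s) (nv s') & clps C = videm K v.
  case/(hasse_walk_ex S0)=> q [qP qE].
  exists (pathw v (new_vert T s) (map nw q)).
    by apply: (@pathw_pspace _ _ _ _ _ S0 (nv s) (nv s')); rewrite raw_end_new qE.
  have [e es ea] := triv_path v; rewrite (videm_delta K es ea).
  by apply: collapse_pathw; rewrite ?pmap_new ?raw_walk_new.
have combP (z z' : vert Q') (u : qpath T -> KQ') :
    (forall p, pcoef f p != 0 -> u p \in pspace K z z') ->
    \sum_p pcoef f p *: u p \in pspace K z z'.
  move=> uP; apply: rpred_sum => p _.
  by case: (eqVneq (pcoef f p) 0) => [->|/uP]; [rewrite scale0r mem0v | apply: rpredZ].
case: x y => [[i|s] vx] [[j|s'] vy] /= fP.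
- move=> _; have [tilde tP] : exists tilde : qpath T -> KQ',
      forall p, pcoef f p != 0 -> is_tilde p (tilde p).
    suff H p : exists u : KQ', pcoef f p != 0 -> is_tilde p u.
      by have [tilde tP] := boolp.choice H; exists tilde.
    case: (eqVneq (pcoef f p) 0) => [_|/(elimT (pspaceP _ _ _) fP)[sp _]].
      by exists 0.
    by have [|u uP] := @tilde_ex p; [rewrite sp | exists u].
  have wordP p : pcoef f p != 0 -> exists w, [/\ tilde p = pathw v (old_vert S i) w,
    raw_walk v (old_vert S i) w, pstart p = i, pmap carr w = parrows p &
    raw_end (old_vert S i) w = old_vert S j].
    move=> nz; have [sp ep] := elimT (pspaceP _ _ _) fP p nz.
    have := tilde_word (tP p nz); rewrite sp ep => /(_ vx vy)[w [? ? ? ?]].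
    by exists w.
  exists (\sum_p pcoef f p *: tilde p); split.
  + apply: combP => p /wordP[w [-> _ _ _ we]].
    exact: (@pathw_pspace _ _ _ _ _ S0 (exist _ (inl i) vx) (exist _ (inl j) vy)).
  + apply: collapse_comb => p /wordP[w [-> wP sp wa we]].
    by apply: collapse_pathw wP _ wa; rewrite sp.
  move=> fI; apply: mem_ideal_gen.
  by apply: (ins_rel_3 fI (elimT (pspaceP _ _ _) fP)).
(* The membership proofs in vx and vy are made canonical to match nv. *)
- have vyE : vy = isT by apply: eq_irrelevance.
  subst vy; move=> _; have [s0 m0] := smin_ex S0.
  have [C CP CC] := chainP _ _ (smin_le s' m0).
  have fs := elimT (pspaceP _ _ _) fP.
  have [G [GP GC GI]] : exists G, [/\ G \in pspace K (exist _ (inl i) vx : vert Q') (nv s0),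
      clps G = f & f \in tideal T -> G \in ins_ideal v S0].
    exists (\sum_p pcoef f p *:
              pathw v (old_vert S (pstart p)) (set_last S0 (parrows p) s0)).
    have p0 p : pcoef f p != 0 -> parrows p != [::].
      move/fs=> [sp ep]; apply: contraNneq vx => p0.
      by rewrite /= -sp -ep /pend p0.
    split.
    + apply: combP => p nz; have [sp ep] := fs p nz; rewrite sp.
      apply: (@pathw_pspace _ _ _ _ _ S0 (exist _ (inl i) vx) (nv s0)).
      by apply: raw_end_set_last; apply: p0.
    + apply: collapse_comb => p nz; have [_ ep] := fs p nz.
      apply: collapse_pathw => //; last exact: pmap_set_last.
      exact: raw_walk_set_last (parrowsP p) (p0 _ nz) ep.
    by move=> fI; apply: mem_ideal_gen; apply: ins_rel_1a fI fs m0.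
  exists (G * C); split; first exact: pspaceM GP CP.
    by rewrite (collapseM GP CP) GC CC; apply: pspace_videmr fP.
  by move=> /GI; case/(idI C).
- have vxE : vx = isT by apply: eq_irrelevance.
  subst vx; move=> _; have [s1 m1] := smax_ex S0.
  have [C CP CC] := chainP _ _ (le_smax s m1).
  have fs := elimT (pspaceP _ _ _) fP.
  have [G [GP GC GI]] : exists G, [/\ G \in pspace K (nv s1) (exist _ (inl j) vy : vert Q'),
      clps G = f & f \in tideal T -> G \in ins_ideal v S0].
    exists (\sum_p pcoef f p *:
              pathw v (new_vert T s1) (set_first S0 s1 (parrows p))).
    have p0 p : pcoef f p != 0 -> parrows p != [::].
      move/fs=> [sp ep]; apply: contraNneq vy => p0.
      by rewrite /= -sp -ep /pend p0.
    split.
    + apply: combP => p nz; have [sp ep] := fs p nz.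
      apply: (@pathw_pspace _ _ _ _ _ S0 (nv s1) (exist _ (inl j) vy)).
      by rewrite (raw_end_set_first _ _ (pstart p)) ?p0 //= -ep.
    + apply: collapse_comb => p nz; have [sp _] := fs p nz.
      have pP := parrowsP p; rewrite sp in pP.
      apply: collapse_pathw; last exact: pmap_set_first.
        exact: raw_walk_set_first.
      by rewrite sp.
    by move=> fI; apply: mem_ideal_gen; apply: ins_rel_1b fI fs m1.
  exists (C * G); split; first exact: pspaceM CP GP.
    by rewrite (collapseM CP GP) CC GC; apply: pspace_videml fP.
  by move=> /GI; case/(idI C).
have [vxE vyE] : vx = isT /\ vy = isT by split; apply: eq_irrelevance.
subst vx vy; case/chainP=> C CP CC; have [a fE] := loop_coef (T := T) fP.
exists (a *: C); split; first exact: rpredZ.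
  by rewrite linearZ /= CC -fE.
rewrite fE; case: (eqVneq a 0) => [->|a0 vI]; first by rewrite !scale0r !mem0v.
by case/negP: (videm_notin v); rewrite -[videm K v](scalerK a0) rpredZ.
Qed.

Lemma collapse_pspace (x y : vert Q') (g : KQ') : g \in pspace K x y ->
  clps g \in pspace K (collapse_vert v (val x)) (collapse_vert v (val y)).
Proof.
move=> /pspaceP gP; apply/pspaceP => p /path_push_supp[r nz <-].
have [<- <-] := gP _ nz.
by split; [exact: collapse_start | exact: collapse_end].
Qed.

(** The collapse of g determines g, hence g is the lift of a relation if its
    collapse is a relation. *)
Lemma collapse_mem_ideal (x y : vert Q') (g : KQ') : ins_reach (val x) (val y) ->
  g \in pspace K x y -> (clps g \in tideal T) = (g \in ins_ideal v S0).
Proof.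
move=> xy gP; apply/idP/idP => gI.
  have [h [hP hg hI]] := lift_ex (collapse_pspace gP) xy.
  suff -> : g = h by apply: hI.
  apply/eqP; rewrite -subr_eq0; apply/eqP/(collapse_inj (x := x) (y := y)).
    by rewrite rpredB.
  by rewrite linearB /= hg subrr.
rewrite -(pspace_videmr gP) -{1}(pspace_videml gP).
exact: collapse_ideal.
Qed.

Lemma hdim_insertion (x y : vert T') : ins_reach (val x) (val y) ->
  hdim x y = hdim (collapse_vert v (val x)) (collapse_vert v (val y)).
Proof.
move=> xy; apply: (@hdim_transfer K T' T clps).
  apply/eqP; rewrite eqEsubv; apply/andP; split; apply/subvP => f.
    by case/memv_imgP=> g gP ->; apply: collapse_pspace.
  by case/lift_ex=> [//|g [gP <- _]]; apply/memv_imgP; exists g.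
by move=> g; apply: collapse_mem_ideal.
Qed.

(** A path between elements of S collapses to a closed path, which is trivial;
    hence it stays inside S, where it goes upwards. *)
Lemma hdim_insertion0 (s s' : S) (x y : vert T') :
  val x = new_vert T s -> val y = new_vert T s' -> (s' < s)%O -> hdim x y = 0%N.
Proof.
move=> xs ys ss'; apply: hdim_eq0; apply/negP => /existsP[r /andP[/eqP sr /eqP er]].
have [cw ce] := collapse_walk (parrowsP r).
have r0 : pmap carr (map val (parrows r)) = [::].
  apply: quiver_acyclic cw _; rewrite ce -/(pend r) sr er.
  by rewrite xs ys.
case: (eqVneq (parrows r) [::]) => [a0|aN].
  have : val (pstart r) = val (pend r) by rewrite /pend a0.
  by rewrite sr er xs ys => -[e]; rewrite e ltxx in ss'.
have [t [t' []]] := ins_walk_new (parrowsP r) r0 aN.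
rewrite -/(pend r) sr er xs ys => -[<-] [<-] /(lt_trans ss').
by rewrite ltxx.
Qed.

End ChainInsertion.

(** * Coxeter polynomials *)

Lemma size_recurrence (p q : {poly int}) : p != 0 -> size q = (size p).+1 ->
  size (('X + 1) * q - 'X * p) = (size q).+1.
Proof.
move=> p0 qp; have q0 : q != 0 by rewrite -size_poly_gt0 qp.
have mon : 'X + 1 \is @monic int.
  by rewrite -[1]opprK -polyC1 -polyCN monicXsubC.
have sq : size (('X + 1) * q) = (size q).+1.
  by rewrite size_monicM // -polyC1 size_XaddC.
by rewrite size_polyDl // size_polyN -commr_polyX size_mulX // sq qp.
Qed.

Section CoxeterPolynomial.
Variable (K : fieldType).

Definition coxeter_fdet (I : finType) (f : I -> I -> nat) : {poly int} :=
  fdet (fun i j => 'X * (f i j)%:R + (f j i)%:R).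

Lemma coxeter_polyE (A : based_algebra K) (f : points A -> points A -> nat) :
  (forall i j, cartan A i j = (f (enum_val i) (enum_val j))%:R) ->
  coxeter_poly A = coxeter_fdet f.
Proof.
rewrite /coxeter_poly /coxeter_fdet /fdet; move: (cartan A) => C Af.
by congr (\det _); apply/matrixP => i j; rewrite !mxE !Af !rmorph_nat.
Qed.

Lemma coxeter_poly_whole (T : triangular K) :
  coxeter_poly (whole_algebra T) = coxeter_fdet (fun i j : vert T => hdim j i).
Proof. by apply: coxeter_polyE => i j; rewrite cartan_whole. Qed.

Lemma coxeter_poly_corner (T : triangular K) (v : vert T) :
  coxeter_poly (corner_algebra v) =
  coxeter_fdet (fun i j : {x : vert T | x != v} => hdim (val j) (val i)).
Proof. by apply: coxeter_polyE => i j; rewrite cartan_corner. Qed.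

Lemma size_coxeter_poly (A : based_algebra K) : \det (cartan A) = 1 ->
  size (coxeter_poly A) = #|points A|.+1.
Proof. exact: size_det_coxeter. Qed.

Variables (T : triangular K) (v : vert T).

Lemma det_cartan_whole : \det (cartan (whole_algebra T)) = 1.
Proof.
rewrite -det_tr; apply: (det_unitriangular (rk := fun i => reach_rank (enum_val i))).
  by move=> i; rewrite mxE cartan_whole hdim_diag.
move=> i j ij; rewrite mxE cartan_whole pnatr_eq0; apply: hdim_rank.
by apply: contraNneq ij => /enum_val_inj ->.
Qed.

Lemma det_cartan_corner : \det (cartan (corner_algebra v)) = 1.
Proof.
rewrite -det_tr.
apply: (det_unitriangular (rk := fun i => reach_rank (val (enum_val i)))).
  by move=> i; rewrite mxE cartan_corner hdim_diag.
move=> i j ij; rewrite mxE cartan_corner pnatr_eq0; apply: hdim_rank.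
by apply: contraNneq ij => /val_inj/enum_val_inj ->.
Qed.

Definition rest : finType := {x : vert T | x != v}.

(** A single description of the vertices of all algebras of the sequence, including
    the corner (n = 0) and the original algebra (n = 1). *)
Definition chain_points (n : nat) : finType := (rest + 'I_n)%type.

(** The (i, j) entry of the Cartan matrix is dim Hom(P_i, P_j), which counts paths
    from j to i; this is why the arguments of hdim are exchanged. *)
Definition chain_cartan n (i j : chain_points n) : nat :=
  match i, j with
  | inl x, inl y => hdim (val y) (val x)
  | inl x, inr _ => hdim v (val x)
  | inr _, inl y => hdim (val y) v
  | inr s, inr s' => (s' <= s)%N
  end.

Lemma coxeter_chain0 :
  coxeter_poly (chain_sequence v 0) = coxeter_fdet (@chain_cartan 0).
Proof.
rewrite [LHS]coxeter_poly_corner.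
have bh : bijective (inl : rest -> chain_points 0).
  exists (fun z : chain_points 0 =>
    match z with inl x => x | inr s => False_rect rest (notF (ltn_ord s)) end) => //.
  by case=> // -[].
by rewrite /coxeter_fdet (fdet_bij _ bh).
Qed.

Lemma coxeter_chain1 :
  coxeter_poly (chain_sequence v 1) = coxeter_fdet (@chain_cartan 1).
Proof.
rewrite [LHS]coxeter_poly_whole.
pose h (z : chain_points 1) : vert T := if z is inl x then val x else v.
have bh : bijective h.
  exists (fun x => if insub x is Some u then inl (u : rest) else inr ord0).
    case=> [x|s] /=; first by rewrite valK.
    by rewrite insubF ?eqxx // [s]ord1.
  by move=> x; case: insubP => //= /negbNE/eqP.
rewrite /coxeter_fdet (fdet_bij _ bh); apply: eq_fdet => i j.
by case: i j => [x|s] [y|s'] //=; rewrite !ord1 hdim_diag.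
Qed.

Lemma coxeter_chainS n :
  coxeter_poly (chain_sequence v n.+2) = coxeter_fdet (@chain_cartan n.+2).
Proof.
pose T' := chain_insertion v n.+1.
rewrite -[LHS]/(coxeter_poly (whole_algebra T')).
rewrite [LHS]coxeter_poly_whole.
pose h (z : chain_points n.+2) : vert T' :=
  match z with
  | inl x => exist (valid_vert v (S := 'I_n.+2)) (inl (val x)) (valP x)
  | inr s => exist (valid_vert v (S := 'I_n.+2)) (inr s) isT
  end.
have bh : bijective h.
  exists (fun x : vert T' => match val x with
    | inl u => if insub u is Some z then inl (z : rest) else inr ord0
    | inr s => inr s end).
    by case=> [x|s] //=; rewrite valK.
  case=> [[u|s] vx] /=; last by apply: val_inj.
  by rewrite (insubT (fun x => x != v) vx); apply: val_inj.
rewrite /coxeter_fdet (fdet_bij _ bh); apply: eq_fdet => i j.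
suff E (a b : chain_points n.+2) : hdim (h b) (h a) = chain_cartan a b.
  by rewrite !E.
case: a b => [x|s] [y|s'].
1,2,3: by rewrite [LHS]hdim_insertion.
rewrite /=; case: (leqP s' s) => ss'.
  rewrite [LHS]hdim_insertion ?hdim_diag //=.
by rewrite [LHS](@hdim_insertion0 _ _ _ _ _ _ s' s).
Qed.

Lemma coxeter_chainE n :
  coxeter_poly (chain_sequence v n) = coxeter_fdet (@chain_cartan n).
Proof.
by case: n => [|[|n]]; [exact: coxeter_chain0 | exact: coxeter_chain1 |
  exact: coxeter_chainS].
Qed.

Definition shift n (z : chain_points n) : chain_points n.+1 :=
  match z with inl x => inl x | inr s => inr (lift ord0 s) end.

Definition add_min n (o : option (chain_points n)) : chain_points n.+1 :=
  if o is Some z then shift z else inr ord0.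

Lemma add_min_bij n : bijective (@add_min n).
Proof.
exists (fun z : chain_points n.+1 => match z with
  | inl x => Some (inl x)
  | inr s => omap inr (unlift ord0 s) end).
  by case=> [[x|s]|] //=; rewrite ?liftK ?unlift_none.
by case=> [x|s] //=; case: unliftP => [j|] ->.
Qed.

Lemma chain_cartan_shift n (i j : chain_points n) :
  chain_cartan (shift i) (shift j) = chain_cartan i j.
Proof. by case: i j => [x|s] [y|s']. Qed.

(** The two smallest elements of a chain have the same entries with respect to all
    other vertices, and removing the smallest one, or both, leaves the Cartan
    matrices of the shorter chains. *)
Lemma coxeter_fdet_chain n : coxeter_fdet (@chain_cartan n.+2) =
  ('X + 1) * coxeter_fdet (@chain_cartan n.+1) - 'X * coxeter_fdet (@chain_cartan n).
Proof.
pose h (o : option (option (chain_points n))) := add_min (omap (@add_min n) o).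
have bh : bijective h.
  apply: bij_comp; first exact: add_min_bij.
  have [g gK hK] := add_min_bij n.
  by exists (omap g) => -[o|] //=; rewrite ?gK ?hK.
rewrite {1}/coxeter_fdet (fdet_bij _ bh) (fdet_chain (x := 'X)) /=.
- rewrite {1}/coxeter_fdet (fdet_bij _ (add_min_bij n)).
  congr (_ * _ - _ * _); apply: eq_fdet => i j.
    by rewrite !chain_cartan_shift.
  by rewrite !chain_cartan_shift.
- by rewrite mulr1.
- by rewrite mulr1.
- by rewrite mulr0 add0r.
- by rewrite mulr1 addr0.
- by case.
- by case.
Qed.

(** The first two polynomials have as degrees the numbers of vertices, as their
    Cartan matrices have determinant 1; from there on the term ('X + 1) * phi of the
    recurrence dominates. *)
Lemma size_coxeter_step i :
  coxeter_poly (chain_sequence v i) != 0 /\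
  size (coxeter_poly (chain_sequence v i.+1)) =
  (size (coxeter_poly (chain_sequence v i))).+1.
Proof.
elim: i => [|i [phi0 IH]].
  have s0 := size_coxeter_poly det_cartan_corner.
  split; first by rewrite -size_poly_gt0 [X in (0 < X)%N]s0.
  apply: (etrans (size_coxeter_poly det_cartan_whole)).
  apply/esym/(etrans (congr1 S s0)) => /=.
  congr S; rewrite [RHS](cardD1 v) card_sig; congr S.
  by apply: eq_card => x; rewrite !inE andbT.
have phi1 : coxeter_poly (chain_sequence v i.+1) != 0.
  by rewrite -size_poly_gt0 IH.
split=> //; rewrite (coxeter_chainE i.+2) coxeter_fdet_chain -!coxeter_chainE.
exact: size_recurrence.
Qed.

End CoxeterPolynomial.

Unset Implicit Arguments.

Theorem proposition4p22 (K : fieldType) (T : triangular K) (v : vert T) :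
  let phi i := coxeter_poly (chain_sequence v i) in
  (forall i : nat, degree (phi i.+1) = (degree (phi i) + 1)%N) /\
  (forall i : nat, (1 <= i)%N ->
     phi i.+1 = ('X + 1) * phi i - 'X * phi i.-1).
Proof.
move=> phi; split=> [i|[//|i] _]; last first.
  by rewrite /phi !coxeter_chainE coxeter_fdet_chain.
have [phi0 E] := size_coxeter_step v i.
by rewrite /degree [size (phi i.+1)]E addn1 prednK // size_poly_gt0.
Qed.
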